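(* Let $T\in(0,\infty]$. Then, for every $x_0\in\mathbb{R}^n$, the problem $(OCP)_T$ of minimizing $u\mapsto \mathcal{J}_T(x_0,u)$ over $u\in L^q([0,T),\mathbb{R})$ admits a unique minimizer in $L^q([0,T),\mathbb{R})$. Furthermore, the value function $V_T$ is positive definite (i.e. $V_T(0)=0$ and $V_T(x)>0$ for $x\ne 0$) and convex on $\mathbb{R}^n$, and it is strictly convex if $T=\infty$.
   Context: Let $n\ge 1$ be an integer and $q\in(1,\infty)$. $J_n$ is the $n\times n$ Jordan block with eigenvalue $0$ (ones on the superdiagonal, zeros elsewhere) and $e_n$ is the last vector of the canonical basis of $\mathbb{R}^n$. The control system is $\dot x(t)=J_nx(t)+e_nu(t)$, $t\ge 0$, with $x(t)\in\mathbb{R}^n$, $u(t)\in\mathbb{R}$. The function $F:\mathbb{R}^n\to\mathbb{R}_{\ge 0}$ is assumed to be continuously differentiable, convex and positive definite ($F(0)=0$, $F(x)>0$ for $x\neq 0$). For $T\in(0,\infty]$, $x_0\in\mathbb{R}^n$ and $u\in L^q([0,T),\mathbb{R})$, set $\mathcal{J}_T(x_0,u)=\int_0^T\left(\frac{|u(t)|^q}{q}+F(x(t))\right)dt\in[0,\infty]$, where $x(\cdot)$ is the trajectory of the control system with $x(0)=x_0$ and control $u$. The value function is $V_T(x_0)=\inf_{u\in L^q([0,T),\mathbb{R})}\mathcal{J}_T(x_0,u)$. *)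

(* Defs.v *)
From HB Require Import structures.
From mathcomp Require Import all_boot all_order all_algebra.
From mathcomp Require Import all_classical all_reals all_analysis.

Set Implicit Arguments.
Unset Strict Implicit.
Unset Printing Implicit Defensive.

Import Order.TTheory GRing.Theory Num.Theory.
Import numFieldNormedType.Exports.

Local Open Scope classical_set_scope.
Local Open Scope ring_scope.

(* The state space R^n, n >= 1, is the type of column vectors 'cV[R]_n.+1 of
   dimension n.+1, with n : nat arbitrary. *)

Definition jordan0 (R : realType) (n : nat) : 'M[R]_n.+1 :=
  \matrix_(i, j) ((j : nat) == i.+1)%:R.

Definition e_last (R : realType) (n : nat) : 'cV[R]_n.+1 :=
  delta_mx ord_max 0.

(* The interval [0, T) of R; T may be +oo. *)
Definition horizon (R : realType) (T : \bar R) : set R :=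
  [set t | 0 <= t /\ (t%:E < T)%E].

(* L^q([0, T)), before quotienting by a.e. equality: only the values of u on
   [0, T) matter, u \_ [0, T) being the extension by 0 outside of [0, T). *)
Definition Lq (R : realType) (q : R) (T : \bar R) : set (R -> R) :=
  [set u | u \_ (horizon T) \in Lfun (@lebesgue_measure R) q%:E].

(* Caratheodory solutions on [0, T) of x' = J_n x + e_n u, x(0) = x0, in
   integral form; only the values of x and u on [0, T) matter. *)
Definition is_trajectory (R : realType) (n : nat) (T : \bar R)
    (x0 : 'cV[R]_n.+1) (u : R -> R) (x : R -> 'cV[R]_n.+1) : Prop :=
  {within horizon T, continuous x} /\
  forall t, horizon T t -> forall i : 'I_n.+1,
    x t i 0 = x0 i 0 +
      \int[@lebesgue_measure R]_(s in `[0, t])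
        (jordan0 R n *m x s + u s *: e_last R n) i 0.

(* The trajectory; for u in L^q([0, T)) it exists and it is unique on [0, T)
   (the default value cst 0 is then irrelevant). *)
Definition trajectory (R : realType) (n : nat) (T : \bar R)
    (x0 : 'cV[R]_n.+1) (u : R -> R) : R -> 'cV[R]_n.+1 :=
  xget (cst 0) [set x | is_trajectory T x0 u x].

Definition cost (R : realType) (n : nat) (q : R) (F : 'cV[R]_n.+1 -> R)
    (T : \bar R) (x0 : 'cV[R]_n.+1) (u : R -> R) : \bar R :=
  (\int[@lebesgue_measure R]_(t in horizon T)
     (`|u t| `^ q / q + F (trajectory T x0 u t))%R%:E)%E.

Definition value (R : realType) (n : nat) (q : R) (F : 'cV[R]_n.+1 -> R)
    (T : \bar R) (x0 : 'cV[R]_n.+1) : \bar R :=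
  ereal_inf [set cost q F T x0 u | u in Lq q T].

Definition minimizer (R : realType) (n : nat) (q : R) (F : 'cV[R]_n.+1 -> R)
    (T : \bar R) (x0 : 'cV[R]_n.+1) (u : R -> R) : Prop :=
  Lq q T u /\ forall v, Lq q T v -> (cost q F T x0 u <= cost q F T x0 v)%E.

(* In finite dimension, the continuity of x |-> 'd F x is its pointwise
   continuity, i.e. that of all the directional derivatives. *)
Definition continuously_differentiable (R : realType) (n : nat)
    (F : 'cV[R]_n.+1 -> R) : Prop :=
  (forall x, differentiable F x) /\
  (forall v : 'cV[R]_n.+1, continuous (fun x => 'd F x v)).

Definition positive_definite (R : realType) (n : nat)
    (V : 'cV[R]_n.+1 -> \bar R) : Prop :=
  V 0 = 0%E /\ forall x, x != 0 -> (0 < V x)%E.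

(* The library's convex_function is restricted to real-valued functions. *)
Definition econvex (R : realType) (n : nat)
    (V : 'cV[R]_n.+1 -> \bar R) : Prop :=
  forall (x y : 'cV[R]_n.+1) (t : R), 0 <= t <= 1 ->
    (V (t *: x + (1 - t) *: y)%R <= t%:E * V x + (1 - t)%R%:E * V y)%E.

Definition strictly_econvex (R : realType) (n : nat)
    (V : 'cV[R]_n.+1 -> \bar R) : Prop :=
  forall (x y : 'cV[R]_n.+1) (t : R), x != y -> 0 < t < 1 ->
    (V (t *: x + (1 - t) *: y)%R < t%:E * V x + (1 - t)%R%:E * V y)%E.

(* Main.v *)
Require Import Defs.
From HB Require Import structures.
From mathcomp Require Import all_boot all_order all_algebra.
From mathcomp Require Import all_classical all_reals all_analysis.
From mathcomp Require Import measurable_realfun ring lra.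
Import Order.TTheory GRing.Theory Num.Theory.
Import numFieldNormedType.Exports.

Set Implicit Arguments.
Unset Strict Implicit.
Unset Printing Implicit Defensive.

Local Open Scope classical_set_scope.
Local Open Scope ring_scope.

(* For q > 1 the midpoint gap (|a|^q + |b|^q)/2 - |(a + b)/2|^q controls
   |a - b|^q up to an arbitrarily small multiple of |a|^q + |b|^q.  Integrated
   along two trajectories, whose midpoint is again a trajectory, this makes the
   cost uniformly convex in the control.  Hence minimizing sequences are Cauchy
   in L^q (no weak compactness is needed), a subsequence converges almost
   everywhere, the trajectories converge pointwise, and Fatou's lemma makes the
   limit control optimal; the same estimate gives uniqueness.
   The value is finite because a polynomial control steers any state to 0 in
   time 1.  If T = +oo and strict convexity fails at x <> y, optimal controls
   for x and y agree almost everywhere, so the difference of the two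
   trajectories is the free motion from x - y, one coordinate of which is a
   nonzero constant; then F, which is bounded below by a positive constant away
   from 0, has infinite integral along one of them. *)

(** * Powers of the absolute value *)

(** For [x > 0] and [a = ln x], $x^q$ is [x * expR ((q - 1) * a)]; the strict tangent bound for
    [expR] is used twice, at [(q - 1) * a] and at [- a]. *)
Lemma powR_gt_tangent1 (R : realType) (q x : R) :
  1 < q -> 0 <= x -> x != 1 -> 1 + q * (x - 1) < x `^ q.
Proof.
move=> q1; have q0 : 0 < q by lra.
rewrite le_eqVlt => /predU1P[<- _|x0 x1].
  by rewrite powR0 ?gt_eqF//; lra.
set a := ln x.
have ex : x = expR a by rewrite lnK.
have a0 : a != 0 by rewrite ln_eq0.
have -> : x `^ q = x * expR ((q - 1) * a).
  by rewrite -mulr_powRB1 ?ltW// /powR gt_eqF.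
have H1 : 1 + (q - 1) * a < expR ((q - 1) * a).
  by apply: expR_gt1Dx; rewrite mulf_neq0//; lra.
have H2 : 1 - a < x^-1 by rewrite ex -expRN expR_gt1Dx// oppr_eq0.
have H3 : x * (1 - a) < 1.
  by rewrite -[ltRHS](divff (lt0r_neq0 x0)) ltr_pM2l.
have : x * (1 + (q - 1) * a) < x * expR ((q - 1) * a) by rewrite ltr_pM2l.
apply: lt_trans.
have : (q - 1) * (x * (1 - a)) < (q - 1) * 1 by rewrite ltr_pM2l//; lra.
set y := x * a.
rewrite !mulrDr !mulr1 mulrN -/y mulrCA -/y; lra.
Qed.

(** After division by the midpoint [m], the tangent bound at 1 applies to [a / m] and [b / m], and
    its linear terms cancel in the sum. *)
Lemma powR_midpoint_lt (R : realType) (q a b : R) :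
  1 < q -> 0 <= a -> 0 <= b -> a != b ->
  ((a + b) / 2) `^ q < (a `^ q + b `^ q) / 2.
Proof.
move=> q1 a0 b0 ab; set m := (a + b) / 2.
have m0 : 0 < m.
  rewrite lt_def /m divr_ge0 ?addr_ge0// andbT; apply: contra ab => /eqP h.
  apply/eqP; lra.
have scale c : 0 <= c -> c `^ q = m `^ q * (c / m) `^ q.
  move=> c0; rewrite -powRM ?(ltW m0) ?(divr_ge0 c0 (ltW m0))//.
  by rewrite mulrC divfK ?gt_eqF.
have H c : 0 <= c -> c != m -> m `^ q * (1 + q * (c / m - 1)) < c `^ q.
  move=> c0 cm; rewrite (scale c)// ltr_pM2l ?powR_gt0//.
  apply: powR_gt_tangent1; rewrite ?(divr_ge0 c0 (ltW m0))//.
  by apply: contra cm => /eqP h; rewrite -[c](divfK (lt0r_neq0 m0)) h mul1r.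
have am : a != m by apply: contra ab => /eqP; rewrite /m => h; apply/eqP; lra.
have bm : b != m by apply: contra ab => /eqP; rewrite /m => h; apply/eqP; lra.
have Ha := H a a0 am; have Hb := H b b0 bm.
have E : m `^ q * (1 + q * (a / m - 1)) + m `^ q * (1 + q * (b / m - 1)) = m `^ q * 2.
  rewrite -mulrDr; congr (_ * _).
  have -> : b = 2 * m - a by rewrite /m; field.
  by field; rewrite gt_eqF.
lra.
Qed.

(** If the absolute values differ, the triangle inequality reduces to nonnegative reals; otherwise
    [a = - b] and the left-hand side vanishes. *)
Lemma powR_norm_midpoint_lt (R : realType) (q a b : R) :
  1 < q -> a != b ->
  `|(a + b) / 2| `^ q < (`|a| `^ q + `|b| `^ q) / 2.
Proof.
move=> q1 ab; have q0 : 0 < q by lra.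
have [nab|nab] := eqVneq `|a| `|b|; last first.
  apply: le_lt_trans (powR_midpoint_lt _ _ _ nab) => //.
  apply: ge0_ler_powR; rewrite ?nnegrE ?divr_ge0 ?addr_ge0 ?(ltW q0)//.
  by rewrite normrM [X in _ * X]gtr0_norm ?invr_gt0// ler_pM2r ?invr_gt0// ler_normD.
have : a = - b.
  by move/eqP: nab; rewrite eqr_norm2 (negbTE ab) => /eqP.
move=> E; rewrite E addNr mul0r normr0 powR0 ?gt_eqF// normrN.
have b0 : b != 0 by apply: contra ab => /eqP b0; rewrite E b0 oppr0.
have : 0 < `|b| `^ q by rewrite powR_gt0 ?normr_gt0.
lra.
Qed.

Lemma powR_norm_convex (R : realType) (q a b t : R) : 1 < q -> 0 <= t <= 1 ->
  `|t * a + (1 - t) * b| `^ q <= t * `|a| `^ q + (1 - t) * `|b| `^ q.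
Proof.
move=> q1 /andP[t0 t1].
have := convex_powR (ltW q1) (Itv01 t0 t1) (x := `|a|) (y := `|b|).
rewrite !inE/= !in_itv/= !normr_ge0 => /(_ erefl erefl).
rewrite !convRE/=; apply: le_trans.
have t1' : 0 <= 1 - t by lra.
rewrite ge0_ler_powR ?nnegrE ?addr_ge0 ?mulr_ge0 //; first lra.
by rewrite (le_trans (ler_normD _ _))// !normrM (ger0_norm t0) (ger0_norm t1').
Qed.

Lemma continuous_norm_powR (R : realType) (q : R) :
  0 < q -> continuous (fun x : R => `|x| `^ q).
Proof.
move=> q0 x; have [->|x0] := eqVneq x 0.
  rewrite /continuous_at normr0 powR0 ?gt_eqF//.
  apply/cvgrPdist_lt => e e0; near=> y.
  rewrite sub0r normrN ger0_norm ?powR_ge0//.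
  rewrite -[e](@powRr1 _) ?ltW// -[1](mulVf (lt0r_neq0 q0)) powRrM.
  rewrite gt0_ltr_powR ?nnegrE ?powR_ge0//.
  near: y.
  have /cvgrPdist_lt/(_ (e `^ q^-1)) := @cvg_id R (nbhs 0).
  rewrite powR_gt0// => /(_ isT); apply: filterS => y.
  by rewrite sub0r normrN.
apply: (@continuous_comp R R R Num.norm (@powR R ^~ q)); first exact: norm_continuous.
apply: differentiable_continuous; apply/derivable1_diffP.
by apply: derivable_powR; rewrite in_itv/= andbT normr_gt0.
Unshelve. all: by end_near. Qed.

(* A substitute for Clarkson's inequalities, valid for all q > 1: by
   homogeneity one may take a = 1 and |b| <= 1, and the midpoint gap is bounded
   away from 0 on the compact set where b stays away from 1. *)
Lemma powR_norm_midpoint_gap (R : realType) (q e : R) : 1 < q -> 0 < e ->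
  exists2 K, 0 <= K & forall a b : R, `|a - b| `^ q <=
    e * (`|a| `^ q + `|b| `^ q) +
    K * ((`|a| `^ q + `|b| `^ q) / 2 - `|(a + b) / 2| `^ q).
Proof.
move=> q1 e0; have q0 : 0 < q by lra.
pose g (b : R) := (1 + `|b| `^ q) / 2 - `|(1 + b) / 2| `^ q.
have gge0 (a b : R) : 0 <= (`|a| `^ q + `|b| `^ q) / 2 - `|(a + b) / 2| `^ q.
  rewrite subr_ge0; have [->|ab] := eqVneq a b; last exact/ltW/powR_norm_midpoint_lt.
  by rewrite !mulrDl -!splitr.
have gcont : continuous g.
  move=> b; apply: cvgB.
    apply: cvgMl; apply: cvgD; first exact: cvg_cst.
    exact: continuous_norm_powR.
  apply: (@continuous_comp _ _ _ (fun b : R => (1 + b) / 2) (fun x => `|x| `^ q)).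
    by apply: cvgMl; apply: cvgD; [exact: cvg_cst|exact: cvg_id].
  exact: continuous_norm_powR.
(* Chosen so that $|1-b|\le d$ already gives $|1-b|^q\le e$. *)
pose d := Num.min 1 (e `^ q^-1).
have d0 : 0 < d by rewrite lt_min ltr01 powR_gt0.
have d1 : d <= 1 by rewrite ge_min lexx.
have dq : d `^ q <= e.
  rewrite -[leRHS](@powRr1 _ e) ?(ltW e0)// -[1](mulVf (lt0r_neq0 q0)) powRrM.
  by rewrite ge0_ler_powR ?nnegrE ?powR_ge0 ?(ltW d0) ?(ltW q0)// ge_min lexx orbT.
have [c c_in gc] : exists2 c, c \in `[-1, 1 - d] &
    forall t, t \in `[-1, 1 - d] -> g c <= g t.
  apply: EVT_min; first lra.
  exact: continuous_subspaceT.
have gc0 : 0 < g c.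
  have c1 : 1 != c.
    by move: c_in; rewrite in_itv/= => /andP[_ c1]; rewrite eq_sym lt_eqF//; lra.
  by have := powR_norm_midpoint_lt q1 c1; rewrite normr1 powR1 subr_gt0.
(* For $|b|\le 1$ the left-hand side is at most $2^q$, and [g] is at least [g c] on [[-1, 1 - d]],
   so this [K] absorbs it there. *)
pose K := 2 `^ q / g c.
have K0 : 0 <= K by rewrite divr_ge0 ?powR_ge0// ltW.
have key1 b : `|b| <= 1 -> `|1 - b| `^ q <= e + K * g b.
  move=> b1; have /andP[bl bu] : -1 <= b <= 1 by rewrite -ler_norml.
  have [bd|bd] := leP b (1 - d).
    have gcb : g c <= g b by apply: gc; rewrite in_itv/= bd andbT; lra.
    apply: (@le_trans _ _ (K * g c)).
      rewrite /K divfK ?gt_eqF// ge0_ler_powR ?nnegrE ?(ltW q0)//.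
      by apply: le_trans (ler_normB _ _) _; rewrite normr1; lra.
    have : K * g c <= K * g b by rewrite ler_wpM2l.
    lra.
  have : 0 <= K * g b.
    by rewrite mulr_ge0//; have := gge0 1 b; rewrite normr1 powR1.
  have : `|1 - b| `^ q <= d `^ q.
    by rewrite ge0_ler_powR ?nnegrE ?(ltW q0) ?(ltW d0)// ger0_norm; lra.
  lra.
exists K => // a b.
have key (x y : R) : `|y| <= `|x| -> `|x - y| `^ q <=
    e * (`|x| `^ q + `|y| `^ q) +
    K * ((`|x| `^ q + `|y| `^ q) / 2 - `|(x + y) / 2| `^ q).
  have [->|x0] := eqVneq x 0.
    rewrite normr0 normr_le0 => /eqP ->.
    by rewrite normr0 subr0 addr0 mul0r normr0 powR0 ?gt_eqF//; lra.
  move=> yx; set b' := y / x.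
  have b1 : `|b'| <= 1 by rewrite normf_div ler_pdivrMr ?normr_gt0// mul1r.
  have yE : y = x * b' by rewrite mulrC divfK.
  have -> : x - y = x * (1 - b') by rewrite yE; ring.
  have -> : (x + y) / 2 = x * ((1 + b') / 2) by rewrite yE; field.
  rewrite yE !(normrM x) !(powRM _ (normr_ge0 x) (normr_ge0 _)).
  have := ler_wpM2l (powR_ge0 `|x| q) (key1 _ b1); rewrite /g.
  move/le_trans; apply; rewrite -subr_ge0.
  set A := `|x| `^ q; set B := `|b'| `^ q; set C := `|_ / 2| `^ q.
  have -> : e * (A + A * B) + K * ((A + A * B) / 2 - A * C) -
            A * (e + K * ((1 + B) / 2 - C)) = e * A * B by field.
  by rewrite !mulr_ge0 ?powR_ge0 ?(ltW e0).
have [|/ltW] := leP `|b| `|a|; first exact: key.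
by move=> /key; rewrite distrC (addrC (`|b| `^ q)) (addrC b).
Qed.

(** A pointwise substitute for Hölder's inequality: when $|w|>e$, the ratio $|w|/e\ge 1$ is at most
    its own $q$-th power. The additive term can be made as small as desired. *)
Lemma norm_le_powR (R : realType) (q e w : R) : 1 < q -> 0 < e ->
  `|w| <= e + e * e^-1 `^ q * `|w| `^ q.
Proof.
move=> q1 e0; rewrite -mulrA -powRM ?invr_ge0 ?(ltW e0)//.
have [we|ew] := leP `|w| e.
  by rewrite (le_trans we)// lerDl mulr_ge0 ?powR_ge0 ?(ltW e0).
apply: (@le_trans _ _ (e * (e^-1 * `|w|) `^ q)); last by rewrite lerDr (ltW e0).
rewrite -ler_pdivrMl// le1r_powR ?(ltW q1)//.
by rewrite mulrC ler_pdivlMr// mul1r (ltW ew).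
Qed.

(** * Chains of integrators *)

Lemma continuous_Rintegral0 (R : realType) (u : R -> R) :
  (forall t : R, (@lebesgue_measure R).-integrable `[0, t] (EFin \o u)) ->
  continuous (fun t : R => \int[@lebesgue_measure R]_(s in `[0, t]) u s).
Proof.
move=> iu x; set mu := @lebesgue_measure R.
pose b := `|x| + 1; have b0 : 0 < b by rewrite ltr_pwDr.
have xb : -b < x < b by rewrite -ltr_norml ltrDl.
(* Extending [u] by 0 to negative times turns the integral from 0 into one from [-b], so continuity
   at any [x], also at [x <= 0], is continuity at an interior point of [[-b, b]]. *)
pose u1 := u \_ `[0, +oo[.
have itvIE t : -b <= t -> `[-b, t] `&` `[0, +oo[ = `[0, t]%classic :> set R.
  move=> bt; rewrite predeqE => s /=; rewrite !in_itv/= andbT; split.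
    by move=> [/andP[_ ->] ->].
  by move=> /andP[s0 ->]; split => //; rewrite andbT (le_trans _ s0)// oppr_le0 ltW.
have iu1 : mu.-integrable `[-b, b] (EFin \o u1).
  rewrite /u1 -restrict_EFin; apply/integrable_restrict => //.
  by rewrite itvIE // (le_trans (_ : - b <= 0))// ?oppr_le0 ltW.
have := parameterized_integral_continuous (ltW (lt_trans (andP xb).1 (andP xb).2)) iu1.
move/continuous_within_itvP => /(_ (lt_trans (andP xb).1 (andP xb).2))[+ _ _].
move/(_ x); rewrite in_itv/= => /(_ xb).
have E t : - b <= t -> parameterized_integral mu (- b) t u1 = \int[mu]_(s in `[0, t]) u s.
  by move=> bt; rewrite /parameterized_integral -itvIE// Rintegral_mkcondr.
rewrite /continuous_at E ?(ltW (andP xb).1)//; apply: cvg_trans.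
apply: near_eq_cvg; near=> t; rewrite E// ltW//; near: t.
exact: lt_nbhsr (andP xb).1.
Unshelve. all: by end_near. Qed.

Lemma cvg_cV (R : realType) (n : nat) (T : Type) (G : set_system T) {FG : Filter G}
   (f : T -> 'cV[R]_n) (l : 'cV[R]_n) :
  (forall i, f t i 0 @[t --> G] --> l i 0) -> f @ G --> l.
Proof.
move=> fl; apply/cvgrPdist_lt => e e0.
have : \forall t \near G, forall i, `|l i 0 - f t i 0| < e.
  by apply: filter_forall => i; have /cvgrPdist_lt := fl i; apply.
apply: filterS => t lt_e; rewrite /Num.norm/= mx_normrE.
apply/bigmax_ltP; split => // -[i j] _ /=.
by rewrite !mxE (ord1 j).
Qed.

Section chain_of_integrators.
Context {R : realType}.
Local Notation mu := (@lebesgue_measure R).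
Implicit Types (c d : nat -> R) (u v : R -> R).

(* The components of the trajectory, numbered from the control upwards. *)
Fixpoint chain c u m : R -> R :=
  if m is m'.+1 then fun t => c m' + \int[mu]_(s in `[0, t]) chain c u m' s
  else u.

(** Asked for every [t], even beyond the horizon: controls are extended by 0, and chains then live
    on the whole line, independently of [T]. *)
Definition locint u := forall t : R, mu.-integrable `[0, t] (EFin \o u).

Lemma locint_continuous u : continuous u -> locint u.
Proof.
move=> cu t; apply: continuous_compact_integrable; first exact: segment_compact.
exact: continuous_subspaceT.
Qed.

Lemma locint_lty u (t : R) : (forall s, 0 <= u s) -> locint u ->
  (\int[mu]_(s in `[0%R, t]) (u s)%:E < +oo)%E.
Proof.
move=> u0 iu; rewrite -ge0_fin_numE; first exact: (integrable_fin_num _ (iu t)).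
by apply: integral_ge0 => s _; rewrite lee_fin.
Qed.

Lemma chain_locint c u m : locint u -> locint (chain c u m).
Proof.
move=> iu; elim: m => //= m IH; apply: locint_continuous => t.
by apply: cvgD; [exact: cvg_cst|exact: continuous_Rintegral0].
Qed.

Lemma chain_continuous c u m : locint u -> continuous (chain c u m.+1).
Proof.
move=> iu t /=; apply: cvgD; first exact: cvg_cst.
by apply: continuous_Rintegral0; exact: chain_locint.
Qed.

Lemma chain_linear c d u v (a b : R) m t : locint u -> locint v ->
  chain (fun k => a * c k + b * d k) (fun s => a * u s + b * v s) m t =
  a * chain c u m t + b * chain d v m t.
Proof.
move=> iu iv; elim: m t => //= m IH t.
under eq_Rintegral do rewrite IH.
rewrite RintegralD// ?RintegralZl//.
- by ring.
- exact: chain_locint.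
- exact: chain_locint.
- exact: (integrableZl _ _ (chain_locint c m iu t)).
- exact: (integrableZl _ _ (chain_locint d m iv t)).
Qed.

(** The first integration gives the $L^1$ norm of the control, and each later one, over an interval
    of length at most [t], costs a factor [t]. *)
Lemma chain0_le u m (s t : R) : locint u -> 0 <= s <= t ->
  `|chain (fun=> 0) u m.+1 s| <= t ^+ m * \int[mu]_(r in `[0, t]) `|u r|.
Proof.
move=> iu; have inu r : mu.-integrable `[0, r] (EFin \o (fun r => `|u r|)).
  exact: (integrable_norm (iu r)).
elim: m s => [|m IH] s /andP[s0 st] /=; rewrite add0r.
  rewrite expr0 mul1r; apply: le_trans (le_normr_Rintegral _ (iu s)) _ => //.
  apply: fine_le; [exact: integrable_fin_num|exact: integrable_fin_num|].
  apply: ge0_subset_integral => //.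
  - by have /integrableP[] := inu t.
  - by apply: subset_itvl; rewrite bnd_simp.
set I := \int[mu]_(r in `[0, t]) _.
have I0 : 0 <= I by apply: Rintegral_ge0.
have H := le_normr_Rintegral _ (chain_locint (fun=> 0) m.+1 iu s).
apply: le_trans (H _) _ => //.
apply: (@le_trans _ _ (\int[mu]_(r in `[0, s]) (t ^+ m * I))).
  apply: le_Rintegral => //.
  - exact: (integrable_norm (chain_locint (fun=> 0) m.+1 iu s)).
  - by apply: locint_continuous => ?; exact: cvg_cst.
  - move=> r /=; rewrite in_itv/= => /andP[r0 rs].
    by apply: IH; rewrite r0 (le_trans rs).
rewrite Rintegral_cst//= lebesgue_measure_itv/= lte_fin.
have t0 := le_trans s0 st.
have -> : t ^+ m.+1 * I = t ^+ m * I * t by rewrite exprSr mulrAC.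
rewrite ler_wpM2l ?mulr_ge0 ?exprn_ge0//.
by case: ltgtP s0 => //= s0 _; rewrite subr0.
Qed.

Lemma chain_control0 c m t : (forall k, (k < m)%N -> c k = 0) ->
  chain c (fun=> 0) m t = 0.
Proof.
elim: m t => //= m IH t c0; rewrite c0// add0r.
have c0' k : (k < m)%N -> c k = 0 by move=> km; exact/c0/ltnW.
under eq_Rintegral do rewrite IH//.
by rewrite Rintegral_cst// mul0r.
Qed.

End chain_of_integrators.

(** * Trajectories *)

Section horizon.
Context {R : realType}.
Implicit Types (T : \bar R) (D : set R).

Lemma measurable_horizon T : measurable (horizon T : set (measurableTypeR R)).
Proof.
case: T => [r||].
- rewrite (_ : horizon _ = `[0, r[%classic)//.
  by rewrite predeqE => t; rewrite /horizon/= in_itv/= lte_fin; split=> [[-> ->]|/andP[]].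
- rewrite (_ : horizon _ = `[0, +oo[%classic)//.
  by rewrite predeqE => t; rewrite /horizon/= in_itv/= ltry andbT; split=> [[]|].
- rewrite (_ : horizon _ = set0)//.
  by rewrite predeqE => t; rewrite /horizon/= ltNge leNye; split=> [[]|].
Qed.

Lemma horizon_itv T t : horizon T t -> `[0, t] `<=` horizon T.
Proof.
move=> [t0 tT] s /=; rewrite in_itv/= => /andP[s0 st]; split => //.
by rewrite (le_lt_trans _ tT)// lee_fin.
Qed.

End horizon.

Section flow.
Context {R : realType} {n : nat}.
Local Notation mu := (@lebesgue_measure R).
Implicit Types (x y : 'cV[R]_n.+1) (u v : R -> R) (T : \bar R).

Lemma dynamicsE x (c : R) (i : 'I_n.+1) :
  (jordan0 R n *m x + c *: e_last R n) i 0 =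
  if (i : nat) == n then c else x (inord i.+1) 0.
Proof.
rewrite !mxE eqxx andbT; have [iN|iN] := eqVneq (i : nat) n.
  have -> : i == ord_max by apply/eqP/val_inj.
  rewrite mulr1 big1 ?add0r// => j _; rewrite mxE iN.
  by rewrite [_ == _]ltn_eqF ?mul0r// ltn_ord.
have -> : (i == ord_max) = false by apply: contra_neqF iN => /eqP ->.
rewrite mulr0 addr0 (bigD1 (inord i.+1))//= mxE inordK; last first.
  by rewrite ltnS ltn_neqAle iN -ltnS ltn_ord.
rewrite eqxx mul1r big1 ?addr0// => j ji; rewrite mxE.
case: eqVneq => [jE|]; last by rewrite mul0r.
by case/eqP: ji; apply: val_inj; rewrite /= -jE inordK// jE ltn_ord.
Qed.

(** Index 0 is the last coordinate, the one driven directly by the control. *)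
Definition rev_coord x (m : nat) : R := x (inord (n - m)) 0.

(** The explicit trajectory: coordinate [i] is reached from the control after [n.+1 - i]
    integrations. *)
Definition flow x u (t : R) : 'cV[R]_n.+1 :=
  \col_i chain (rev_coord x) u (n.+1 - i) t.

Lemma rev_coord_sub x (i : 'I_n.+1) : rev_coord x (n - i) = x i 0.
Proof. by rewrite /rev_coord subKn ?inord_val// -ltnS ltn_ord. Qed.

Lemma flowE x u t (i : 'I_n.+1) : flow x u t i 0 = x i 0 +
  \int[mu]_(s in `[0, t]) (jordan0 R n *m flow x u s + u s *: e_last R n) i 0.
Proof.
rewrite !mxE subSn -1?ltnS ?ltn_ord//= rev_coord_sub; congr (_ + _).
apply: eq_Rintegral => s _; rewrite dynamicsE.
have [->|iN] := eqVneq (i : nat) n; first by rewrite subnn.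
rewrite mxE inordK; last by rewrite ltnS ltn_neqAle iN -ltnS ltn_ord.
by rewrite subSS.
Qed.

Lemma flow_continuous x u : locint u -> continuous (flow x u).
Proof.
move=> iu t; apply: cvg_cV => i.
rewrite mxE subSn -1?ltnS ?ltn_ord//.
under eq_fun do rewrite mxE subSn -1?ltnS ?ltn_ord//.
exact: chain_continuous.
Qed.

Lemma flow_is_trajectory T x u : locint u -> is_trajectory T x u (flow x u).
Proof.
move=> iu; split; first by apply: continuous_subspaceT; exact: flow_continuous.
by move=> t _ i; rewrite -flowE.
Qed.

(** Uniqueness without a Gronwall argument: [jordan0] is nilpotent, so each coordinate is determined
    by the next one, by induction on the distance [n.+1 - i] from the control. *)
Lemma is_trajectory_flow T x u X : is_trajectory T x u X ->
  {in horizon T, X =1 flow x u}.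
Proof.
move=> [_ XE] t /set_mem tT; apply/matrixP => i j; rewrite (ord1 j) {j} mxE.
rewrite -[i in LHS](inord_val i).
have : (0 < n.+1 - i <= n.+1)%N by rewrite subn_gt0 ltn_ord leq_subr.
rewrite -[X in inord X](subKn (ltnW (ltn_ord i))).
elim: (_ - i)%N t tT => // m IH t tT m_n.
rewrite XE//=.
have mn : (m <= n)%N by [].
rewrite subSS /rev_coord; congr (_ + _).
apply: eq_Rintegral => s /[!inE] st; rewrite dynamicsE inordK ?ltnS ?leq_subr//.
case: m mn IH m_n => [|m] mn IH m_n; first by rewrite subn0 eqxx.
rewrite ltn_eqF ?ltn_subrL// ?(leq_ltn_trans _ mn)//; last first.
have -> : (n - m.+1).+1 = (n.+1 - m.+1)%N by rewrite subSn.
by apply: IH; [exact: (horizon_itv tT)|exact: ltnW].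
Qed.

Lemma trajectory_flow T x u : locint u ->
  {in horizon T, trajectory T x u =1 flow x u}.
Proof.
move=> iu; apply: is_trajectory_flow.
apply: (@xgetPex _ _ [set X | is_trajectory T x u X]).
by exists (flow x u); exact: flow_is_trajectory.
Qed.

(** The two sets from which [xget] chooses coincide, so the choices agree even for controls without
    a trajectory. *)
Lemma eq_trajectory T x u v : {in horizon T, u =1 v} ->
  trajectory T x u = trajectory T x v.
Proof.
suff H u' v' X : {in horizon T, u' =1 v'} -> is_trajectory T x u' X ->
    is_trajectory T x v' X.
  move=> uv; congr xget; apply/predeqP => X; split; first exact: H.
  by apply: H => t tT; rewrite uv.
move=> uv [cX XE]; split => // t tT i; rewrite XE//; congr (_ + _).
apply: eq_Rintegral => s /[!inE] st; rewrite !dynamicsE; case: ifP => // _.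
by apply: uv; rewrite inE; exact: (horizon_itv tT).
Qed.

Lemma flow_linear x y u v (a b t : R) : locint u -> locint v ->
  flow (a *: x + b *: y) (fun s => a * u s + b * v s) t =
  a *: flow x u t + b *: flow y v t.
Proof.
move=> iu iv; apply/matrixP => i j; rewrite !mxE -chain_linear//.
by congr chain; apply/funext => k; rewrite /rev_coord !mxE.
Qed.

(** By linearity the difference is the flow from 0 under the control [u - v], to which [chain0_le]
    applies. *)
Lemma flow_dist x u v (t : R) (i : 'I_n.+1) : locint u -> locint v -> 0 <= t ->
  `|flow x u t i 0 - flow x v t i 0| <=
  t ^+ (n - i) * \int[mu]_(s in `[0, t]) `|u s - v s|.
Proof.
move=> iu iv t0.
have iuv : locint (fun s => 1 * u s + -1 * v s).
  move=> s; rewrite (_ : EFin \o _ = (EFin \o u \- (EFin \o v))%E).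
    exact: integrableB.
  by apply/funext => r /=; rewrite mul1r mulN1r EFinB.
have := @flow_linear x x u v 1 (-1) t iu iv.
rewrite !scale1r scaleN1r subrr scaleN1r => /matrixP/(_ i 0).
rewrite [X in _ = X -> _]mxE [X in _ = _ + X -> _]mxE => <-.
rewrite mxE (_ : rev_coord 0 = fun=> 0); last first.
  by apply/funext => k; rewrite /rev_coord mxE.
rewrite subSn -1?ltnS ?ltn_ord//.
have tt : 0 <= t <= t by rewrite t0 lexx.
apply: (le_trans (chain0_le _ iuv tt)).
by under eq_Rintegral do rewrite mul1r mulN1r.
Qed.

(* i is the last nonzero coordinate of x. *)
Lemma flow_control0_coord x : x != 0 ->
  exists2 i, x i 0 != 0 & forall t, flow x (fun=> 0) t i 0 = x i 0.
Proof.
move=> x0; have [i0 xi0] : exists i, x i 0 != 0.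
  apply/not_existsP => h; case/eqP: x0; apply/matrixP => i j.
  by rewrite (ord1 j) mxE; apply/eqP/negPn/negP/h.
have [i xi imax] := @arg_maxnP _ i0 (fun i => x i 0 != 0) (@nat_of_ord _) xi0.
exists i => // t; rewrite mxE subSn -1?ltnS ?ltn_ord//= rev_coord_sub.
under eq_Rintegral.
  move=> s _; rewrite chain_control0; last first.
    move=> k ki; apply/eqP/negPn/negP => /imax; apply/negP.
    rewrite inordK ?ltnS ?leq_subr// -ltnNge ltn_subRL addnC.
    by rewrite -ltn_subRL.
  over.
by rewrite Rintegral_cst// mul0r addr0.
Qed.

End flow.

(** * Steering to the origin by polynomials *)

Section polynomial_steering.
Context {R : realType}.
Local Notation mu := (@lebesgue_measure R).
Implicit Types (p r : {poly R}).

(** Each derivation removes at most one factor ['X - c%:P]. *)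
Lemma root_derivn_dvd p (c : R) (N k : nat) : (k < N)%N ->
  (('X - c%:P) ^+ N %| p)%R -> (p^`(k)).[c] = 0.
Proof.
move=> kN /dvdpP[r ->].
suff [s ->] : exists s, (r * ('X - c%:P) ^+ N)^`(k) = s * ('X - c%:P) ^+ (N - k).
  by rewrite hornerM horner_exp hornerXsubC subrr expr0n subn_eq0 leqNgt kN mulr0.
elim: k kN => [|k IH] kN; first by exists r; rewrite derivn0 subn0.
have [s sE] := IH (ltnW kN); rewrite derivnS sE.
exists (s^`() * ('X - c%:P) + s *+ (N - k)).
have -> : (N - k = (N - k.+1).+1)%N by rewrite subnSK// ltnW.
by rewrite derivM deriv_exp derivXsubC mul1r /= mulrDl exprS mulrnAr mulrnAl mulrA.
Qed.

(** A Bezout relation between $X^N$ and $(X-1)^N$ gives a polynomial congruent modulo $X^N$ to the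
    Taylor polynomial [p0] of the data, and divisible by $(X-1)^N$. *)
Lemma exists_hermite_poly (N : nat) (c : nat -> R) : exists p, forall k, (k < N)%N ->
  (p^`(k)).[0] = c k /\ (p^`(k)).[1] = 0.
Proof.
pose p0 := \poly_(k < N) (c k / k`!%:R).
have cop : coprimep ('X ^+ N : {poly R}) (('X - 1%:P) ^+ N).
  apply/coprimep_expl/coprimep_expr.
  by rewrite coprimep_XsubC rootE hornerX oner_eq0.
have [[a b] /= ab] := Bezout_eq1_coprimepP _ _ cop.
exists (p0 * (b * ('X - 1%:P) ^+ N)) => k kN; split; last first.
  by apply: (root_derivn_dvd kN); rewrite mulrA dvdp_mull.
have -> : p0 * (b * ('X - 1%:P) ^+ N) = p0 - p0 * a * ('X - 0%:P) ^+ N.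
  by rewrite subr0 -[in X in _ = X - _](mulr1 p0) -ab; ring.
rewrite derivnB hornerD hornerN (@root_derivn_dvd (_ * _ * _) 0 N)// ?dvdp_mull//.
rewrite subr0 horner_coef0 coef_derivn addn0 coef_poly kN ffactnn.
by rewrite -(mulr_natr (c k / _)) divfK// pnatr_eq0 -lt0n fact_gt0.
Qed.

Lemma continuous_horner p : continuous (horner p).
Proof.
move=> t; apply: differentiable_continuous; apply/derivable1_diffP.
exact: derivable_horner.
Qed.

Lemma Rintegral_deriv_poly p (a : R) : 0 <= a ->
  \int[mu]_(s in `[0, a]) p^`().[s] = p.[a] - p.[0].
Proof.
rewrite le_eqVlt => /predU1P[<-|a0]; first by rewrite set_itv1 Rintegral_set1 subrr.
rewrite /Rintegral (@continuous_FTC2 _ _ (horner p))//.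
- by apply: continuous_subspaceT; exact: continuous_horner.
- split.
  + by move=> t _; exact: derivable_horner.
  + by apply: cvg_at_right_filter; exact: continuous_horner.
  + by apply: cvg_at_left_filter; exact: continuous_horner.
- by move=> t _; rewrite -derivE.
Qed.

(* With p as in exists_hermite_poly, the control p^(N) on [0, 1], extended by 0,
   brings the chain to rest at time 1. *)
Lemma chain_poly p N (c : nat -> R) m t : (m <= N)%N -> 0 <= t ->
  (forall k, (k < N)%N -> (p^`(k)).[0] = c (N.-1 - k)%N /\ (p^`(k)).[1] = 0) ->
  chain c (horner p^`(N) \_ `[0, 1]) m t = (horner p^`(N - m) \_ `[0, 1]) t.
Proof.
move=> + + pc; elim: m t => [|m IH] t mN t0 /=; first by rewrite subn0.
have kN : (N - m.+1 < N)%N by rewrite ltn_subrL (leq_trans _ mN).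
have [p0 p1] := pc _ kN.
have cE : c m = (p^`(N - m.+1)).[0].
  by rewrite p0 -predn_sub; congr c; case: N mN {pc kN p0 p1 IH} => //= N mN; rewrite subKn.
have -> : \int[mu]_(s in `[0, t]) chain c (horner p^`(N) \_ `[0, 1]) m s =
    \int[mu]_(s in `[0, t]) (horner p^`(N - m) \_ `[0, 1]) s.
  apply: eq_Rintegral => s /[!inE]/=; rewrite in_itv/= => /andP[s0 _].
  by rewrite IH// ltnW.
rewrite -Rintegral_mkcondr.
(* Beyond time 1 the integral stays at its value at 1, where the derivatives of [p] of order below
   [N] vanish; this reproduces the extension by 0. *)
have -> : `[0, t] `&` `[0, 1] = `[0, Num.min t 1]%classic :> set R.
  rewrite predeqE => s /=; rewrite !in_itv/= le_min.
  by split=> [[/andP[-> ->] /andP[_ ->]]|/and3P[-> -> ->]].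
have -> : p^`(N - m) = (p^`(N - m.+1))^`() by rewrite -derivnS subnSK.
rewrite cE Rintegral_deriv_poly ?le_min ?t0 ?ler01// subrKC patchE.
case: ifPn => [|].
  by rewrite inE/= in_itv/= t0/= => t1; rewrite min_l.
rewrite notin_setE/= in_itv/= t0/= => /negP; rewrite -ltNge => t1.
by rewrite min_r ?ltW.
Qed.

End polynomial_steering.

(** * Lebesgue spaces *)

Lemma measurable_norm_powR d (X : measurableType d) (R : realType) (D : set X)
    (q : R) (u : X -> R) : measurable_fun D u ->
  measurable_fun D (fun t => `|u t| `^ q).
Proof.
move=> mf; apply: (@measurableT_comp _ _ _ _ _ _ (@powR R ^~ q)).
  exact: measurable_powR.
exact: measurableT_comp.
Qed.

(** Fatou's lemma: almost everywhere [f] is the lower limit of the [f_ k]. It passes bounds on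
    norms, distances and costs to the limit control. *)
Lemma le_integral_lim d (X : measurableType d) (R : realType)
  (mu : {measure set X -> \bar R}) (D : set X) (f_ : nat -> X -> R) (f : X -> R) (C : R) :
  measurable D -> (forall k, measurable_fun D (f_ k)) -> measurable_fun D f ->
  (forall k t, 0 <= f_ k t) -> (forall t, 0 <= f t) ->
  {ae mu, forall t, D t -> f_ ^~ t @ \oo --> f t} ->
  (\forall k \near \oo, \int[mu]_(t in D) (f_ k t)%:E <= C%:E)%E ->
  (\int[mu]_(t in D) (f t)%:E <= C%:E)%E.
Proof.
move=> mD mf_ mf f_0 f0 f_f f_C.
have mEf_ k : measurable_fun D (EFin \o f_ k) by apply/measurable_EFinP.
apply: (@le_trans _ _ (\int[mu]_(t in D) limn_einf (fun k => (f_ k t)%:E))%E).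
  apply: ae_ge0_le_integral => //.
  - by move=> t _; rewrite lee_fin.
  - exact/measurable_EFinP.
  - move=> t _; rewrite limn_einf_lim; apply: lime_ge.
      exact: is_cvg_einfs.
    by near=> k; apply: le_ereal_inf_tmp => _ [j _ <-]; rewrite lee_fin.
  - apply: measurableT_comp; first exact: oppe_measurable.
    apply: measurable_fun_limn_esup => k.
    by apply: measurableT_comp (mEf_ k); exact: oppe_measurable.
  - apply: filterS f_f => t f_t tD.
    have /cvg_limn_einf_sup[-> _] // : (f_ k t)%:E @[k --> \oo] --> (f t)%:E.
    by apply/cvg_EFin; [near=> k|exact: f_t].
apply: (le_trans (fatou mu mD mEf_ _)); first by move=> k t _; rewrite lee_fin.
rewrite limn_einf_lim; apply: lime_le; first exact: is_cvg_einfs.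
near=> k; apply: (@le_trans _ _ (\int[mu]_(t in D) (f_ k t)%:E)%E).
  by apply: ereal_inf_lbound; exists k => //=.
by near: k.
Unshelve. all: by end_near. Qed.

Section Lebesgue_space.
Context {R : realType}.
Local Notation mu := (@lebesgue_measure R).
Implicit Types (u v w : R -> R) (q : R).

Lemma Lfun_measurable q u : u \in Lfun mu q%:E -> measurable_fun setT u.
Proof. by move=> /andP[/[!inE]]. Qed.

Lemma Lfun_powRP q u : 0 < q -> u \in Lfun mu q%:E <->
  measurable_fun setT u /\ (\int[mu]_t (`|u t| `^ q)%:E < +oo)%E.
Proof.
move=> q0; have q0' : q^-1 != 0 by rewrite gt_eqF ?invr_gt0.
split=> [/andP[/[!inE] mf fin]|[mf fin]].
  split=> //; move: fin; rewrite /= /finite_norm unlock/=.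
  exact: (lty_poweRy q0').
apply/andP; rewrite !inE; split=> //; rewrite /= /finite_norm unlock/=.
exact: poweR_lty.
Qed.

Lemma Lfun_comb q u v (a b : R) : 1 < q ->
  u \in Lfun mu q%:E -> v \in Lfun mu q%:E ->
  (fun t => a * u t + b * v t) \in Lfun mu q%:E.
Proof.
move=> q1 Lu Lv; have q1' : (1 <= q%:E)%E by rewrite lee_fin ltW.
have [L0 LZ] := Lfun_submod_closed mu q1'.
have Lbv : (b *: v : R -> R) \in Lfun mu q%:E by rewrite -[_ *: _]addr0; exact: LZ.
exact: (LZ a u _ Lu Lbv).
Qed.

Lemma Lfun_restrict q u (D : set R) : 0 < q -> measurable D ->
  u \in Lfun mu q%:E -> u \_ D \in Lfun mu q%:E.
Proof.
move=> q0 mD /(Lfun_powRP _ q0)[mf fin]; apply/(Lfun_powRP _ q0).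
have mfD : measurable_fun setT (u \_ D).
  by apply/(measurable_restrict _ mD measurableT); exact: measurable_funS mf.
split; first exact: mfD.
apply: le_lt_trans fin; apply: ge0_le_integral => //.
- by apply/measurable_EFinP; exact: measurable_norm_powR.
- by apply/measurable_EFinP; exact: measurable_norm_powR.
- move=> t _; rewrite lee_fin patchE; case: ifP => // _.
  by rewrite normr0 powR0 ?gt_eqF// powR_ge0.
Qed.

(** [norm_le_powR] integrated over [[0, t]]; with [e] small and then [B] small, $L^q$ convergence
    gives $L^1$ convergence on bounded intervals. *)
Lemma integral_norm_le (q e t B : R) (D : set R) u : 1 < q -> 0 < e -> 0 <= t ->
  measurable D -> `[(0 : R), t] `<=` D -> measurable_fun setT u ->
  (\int[mu]_(s in D) (`|u s| `^ q)%:E <= B%:E)%E ->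
  (\int[mu]_(s in `[0%R, t]) `|u s|%:E <= (e * t + e * e^-1 `^ q * B)%:E)%E.
Proof.
move=> q1 e0 t0 mD tD mf B_ge; set C := e * e^-1 `^ q.
have C0 : 0 <= C by rewrite mulr_ge0 ?powR_ge0// ltW.
have mq E : measurable_fun E (fun s => (`|u s| `^ q)%:E).
  by apply/measurable_EFinP; apply: measurable_norm_powR; exact: measurable_funS mf.
apply: (@le_trans _ _ (\int[mu]_(s in `[0%R, t]) (e%:E + C%:E * (`|u s| `^ q)%:E))%E).
  apply: ge0_le_integral => //.
  - by apply/measurable_EFinP; apply: measurableT_comp => //; exact: measurable_funS mf.
  - apply: emeasurable_funD; [exact: measurable_cst|].
    by apply: measurable_funeM; exact: mq.
  - by move=> s _; rewrite -EFinM -EFinD lee_fin; exact: norm_le_powR.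
rewrite ge0_integralD//; last 3 first.
- by move=> s _; rewrite lee_fin ltW.
- by move=> s _; rewrite mule_ge0// lee_fin powR_ge0.
- by apply: measurable_funeM; exact: mq.
rewrite EFinD integral_cst//= lebesgue_measure_itv/= lte_fin ge0_integralZl//; last exact: mq.
apply: leeD.
  by case: ltgtP t0 => // [_ _|<- _]; rewrite ?sube0 -?EFinM ?mulr0 ?mule0.
rewrite [leRHS]EFinM; apply: lee_wpmul2l; first by rewrite lee_fin.
by apply: le_trans B_ge; apply: ge0_subset_integral => //; exact: mq.
Qed.

Lemma Lfun_locint q u : 1 < q -> u \in Lfun mu q%:E -> locint u.
Proof.
move=> q1 /Lfun_powRP[|mf fin]; first lra.
move=> t; apply/integrableP; split.
  by apply/measurable_EFinP; exact: measurable_funS mf.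
have [t0|t0] := leP 0 t; last first.
  by rewrite set_itv_ge ?integral_set0// bnd_simp -ltNge.
set I := (\int[_]_t _)%E in fin.
have If : I \is a fin_num.
  by rewrite ge0_fin_numE// integral_ge0// => s _; rewrite lee_fin powR_ge0.
apply: le_lt_trans (integral_norm_le q1 ltr01 t0 measurableT _ mf (B := fine I) _) _ => //.
- by rewrite fineK.
- exact: ltry.
Qed.

End Lebesgue_space.

(* Markov's inequality in summed form: by the weighted bound norm_le_powR, the
   sum of the |u_(k+1) - u_k| is dominated by a constant plus an integrable
   function. *)
Lemma ae_cvg_powR_summable d (X : measurableType d) (R : realType)
    (mu : {measure set X -> \bar R}) (D : set X) (q : R) (u_ : nat -> X -> R) :
  1 < q -> measurable D -> (forall k, measurable_fun D (u_ k)) ->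
  (forall k, \int[mu]_(t in D) (`|u_ k.+1 t - u_ k t| `^ q)%:E <=
             ((1 / (2 ^ (k + 1))%:R) `^ q)%:E)%E ->
  {ae mu, forall t, D t -> cvgn (u_ ^~ t)}.
Proof.
move=> q1 mD mu_ u_le; pose e k : R := 1 / (2 ^ (k + 1))%:R.
have e0 k : 0 < e k by rewrite divr_gt0// ltr0n expn_gt0.
(* The factor in [norm_le_powR]; it is such that a function with $q$-th power integral at most
   $e_k^q$ contributes at most $e_k$, and the $e_k$ sum to 1. *)
pose C k := e k * (e k)^-1 `^ q.
have C0 k : 0 <= C k by apply: mulr_ge0; rewrite ?powR_ge0// ltW.
pose g k t := C k * `|u_ k.+1 t - u_ k t| `^ q.
have g0 k t : 0 <= g k t by rewrite mulr_ge0 ?powR_ge0.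
have mg k : measurable_fun D (EFin \o g k).
  apply/measurable_EFinP; apply: measurable_funM => //.
  by apply: measurable_norm_powR; exact: measurable_funB.
have Ee : (\sum_(0 <= k <oo) (e k)%:E = 1)%E.
  apply/cvg_lim => //; rewrite -[X in X%:E](@divr1 R) -[1 in X in X%:E](expr0 2).
  exact: (@cvg_geometric_eseries_half R 1 0).
have ge k : (\int[mu]_(t in D) (g k t)%:E <= (e k)%:E)%E.
  rewrite /g; under eq_integral do rewrite EFinM.
  rewrite ge0_integralZl//; last 2 first.
  - by apply/measurable_EFinP; apply: measurable_norm_powR; exact: measurable_funB.
  - by rewrite lee_fin.
  apply: (le_trans (lee_wpmul2l _ (u_le k))); first by rewrite lee_fin.
  rewrite -EFinM lee_fin /C -mulrA -powRM ?invr_ge0 ?(ltW (e0 k))//.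
  by rewrite mulVf ?gt_eqF// powR1 mulr1.
have fin : mu.-integrable D (fun t => \sum_(0 <= k <oo) (g k t)%:E)%E.
  apply/integrableP; split.
    apply: ge0_emeasurable_sum; first by move=> k t tD _; rewrite lee_fin.
    by move=> k _; exact: mg.
  under eq_integral.
    by move=> t _; rewrite gee0_abs ?nneseries_ge0//; [over|move=> k _ _; rewrite lee_fin].
  rewrite integral_nneseries; [|by []|exact: mg|by move=> k t _; rewrite lee_fin].
  apply: (@le_lt_trans _ _ (\sum_(0 <= k <oo) (e k)%:E)%E); last by rewrite Ee ltry.
  by apply: lee_nneseries => // k _ _; apply: integral_ge0 => t _; rewrite lee_fin.
have := integrable_ae mD fin; apply: filterS => t fin_t tD.
have {fin_t} := fin_t tD => fin_t.
have : cvgn (series (fun k => u_ k.+1 t - u_ k t)).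
  apply: normed_cvg; apply: nondecreasing_is_cvgn.
    by apply: nondecreasing_series => *; exact: normr_ge0.
  exists (1 + fine (\sum_(0 <= k <oo) (g k t)%:E)%E) => _ [N _ <-].
  apply: (@le_trans _ _ (\sum_(0 <= k < N) (e k + g k t))).
    by apply: ler_sum => k _; exact: norm_le_powR.
  rewrite big_split/= -lee_fin EFinD EFinD fineK// -Ee -!sumEFin.
  by apply: leeD; apply: nneseries_lim_ge => k _ _; rewrite lee_fin// ltW.
move=> c; have -> : u_ ^~ t = (fun N => u_ 0%N t + series (fun k => u_ k.+1 t - u_ k t) N).
  by apply/funext => N; rewrite /series/= telescope_sumr// subrKC.
by apply: is_cvgD => //; exact: is_cvg_cst.
Qed.

(** * The optimal control problem *)

Section optimal_control.
Context {R : realType} {n : nat}.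
Variables (q : R) (F : 'cV[R]_n.+1 -> R) (T : \bar R).
Hypotheses (q1 : 1 < q) (Fcont : continuous F) (F_ge0 : forall x, 0 <= F x).
Hypothesis Fconv : forall x y (t : R), 0 <= t <= 1 ->
  F (t *: x + (1 - t) *: y) <= t * F x + (1 - t) * F y.
Local Notation mu := (@lebesgue_measure R).
Local Notation D := (horizon T).
Implicit Types (x y : 'cV[R]_n.+1) (u v : R -> R).

Let q0 : 0 < q. Proof. exact: lt_trans q1. Qed.
Let mD : measurable (D : set (measurableTypeR R)). Proof. exact: measurable_horizon. Qed.

(** * The cost along the explicit flow *)

Definition running_cost x u t : R := `|u t| `^ q / q + F (flow x u t).

Definition flow_cost x u : \bar R := (\int[mu]_(t in D) (running_cost x u t)%:E)%E.

Lemma running_cost_ge0 x u t : 0 <= running_cost x u t.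
Proof. by rewrite addr_ge0// divr_ge0 ?powR_ge0// ltW. Qed.

Lemma flow_cost_ge0 x u : (0 <= flow_cost x u)%E.
Proof. by apply: integral_ge0 => t _; rewrite lee_fin running_cost_ge0. Qed.

Lemma measurable_running_cost x u E : u \in Lfun mu q%:E ->
  measurable_fun E (running_cost x u).
Proof.
move=> Lu; apply: (@measurable_funS _ _ _ _ setT) => //.
apply: measurable_funD.
  apply: measurable_funM => //.
  exact: measurable_norm_powR (Lfun_measurable Lu).
apply: continuous_measurable_fun => t; apply: continuous_comp; last exact: Fcont.
by apply: flow_continuous; exact: Lfun_locint Lu.
Qed.

Lemma cost_flow_cost x u : u \in Lfun mu q%:E -> cost q F T x u = flow_cost x u.
Proof.
move=> Lu; apply: eq_integral => t tD.
by rewrite trajectory_flow//; exact: Lfun_locint Lu.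
Qed.

Lemma Lfun_Lq u : u \in Lfun mu q%:E -> Lq q T u.
Proof. by move=> Lu; exact: Lfun_restrict. Qed.

Lemma eq_cost x u v : {in D, u =1 v} -> cost q F T x u = cost q F T x v.
Proof.
move=> uv; apply: eq_integral => t tD.
by rewrite (eq_trajectory _ uv) uv.
Qed.

(** Every admissible control may be replaced by its extension by 0, a genuine $L^q$ function on the
    line; the estimates are stated for those. *)
Lemma cost_Lq x u : Lq q T u -> cost q F T x u = flow_cost x (u \_ D).
Proof.
move=> Lu; rewrite -(cost_flow_cost x Lu); apply: eq_cost => t tD.
by rewrite patchE tD.
Qed.

Lemma value_le x u : u \in Lfun mu q%:E -> (value q F T x <= flow_cost x u)%E.
Proof.
move=> Lu; apply: ereal_inf_lbound; exists u; first exact: Lfun_Lq.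
exact: cost_flow_cost.
Qed.

Lemma value_ge0 x : (0 <= value q F T x)%E.
Proof.
by apply: le_ereal_inf_tmp => _ [u Lu <-]; rewrite cost_Lq// flow_cost_ge0.
Qed.

(** * Convexity of the cost and its gap at midpoints *)

Lemma running_cost_convex x y u v (a t : R) : u \in Lfun mu q%:E -> v \in Lfun mu q%:E ->
  0 <= a <= 1 ->
  running_cost (a *: x + (1 - a) *: y) (fun s => a * u s + (1 - a) * v s) t <=
  a * running_cost x u t + (1 - a) * running_cost y v t.
Proof.
move=> Lu Lv a01; rewrite /running_cost flow_linear;
  [|exact: Lfun_locint Lu|exact: Lfun_locint Lv].
rewrite !mulrDr addrACA lerD ?Fconv// !mulrA -mulrDl ler_pM2r ?invr_gt0//.
exact: powR_norm_convex.
Qed.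

Lemma flow_costZ x u (a : R) : u \in Lfun mu q%:E -> 0 <= a ->
  (\int[mu]_(t in D) (a * running_cost x u t)%:E = a%:E * flow_cost x u)%E.
Proof.
move=> Lu a0; under eq_integral do rewrite EFinM.
rewrite ge0_integralZl//.
- by apply/measurable_EFinP; exact: measurable_running_cost.
- by move=> t _; rewrite lee_fin running_cost_ge0.
Qed.

Lemma flow_costD x y u v (a b : R) : u \in Lfun mu q%:E -> v \in Lfun mu q%:E ->
  0 <= a -> 0 <= b ->
  (\int[mu]_(t in D) (a * running_cost x u t + b * running_cost y v t)%:E =
   a%:E * flow_cost x u + b%:E * flow_cost y v)%E.
Proof.
move=> Lu Lv a0 b0; under eq_integral do rewrite EFinD.
rewrite ge0_integralD//.
- by rewrite !flow_costZ.
- by move=> t _; rewrite lee_fin mulr_ge0// running_cost_ge0.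
- by apply/measurable_EFinP; apply: measurable_funM => //; exact: measurable_running_cost.
- by move=> t _; rewrite lee_fin mulr_ge0// running_cost_ge0.
- by apply/measurable_EFinP; apply: measurable_funM => //; exact: measurable_running_cost.
Qed.

Lemma flow_cost_convex x y u v (a : R) : u \in Lfun mu q%:E -> v \in Lfun mu q%:E ->
  0 <= a <= 1 ->
  (flow_cost (a *: x + (1 - a) *: y) (fun s => a * u s + (1 - a) * v s)%R <=
   a%:E * flow_cost x u + (1 - a)%:E * flow_cost y v)%E.
Proof.
move=> Lu Lv a01; have /andP[a0 a1] := a01.
rewrite -flow_costD ?subr_ge0//; apply: ge0_le_integral => //.
- by move=> t _; rewrite lee_fin running_cost_ge0.
- by apply/measurable_EFinP; apply: measurable_running_cost; exact: Lfun_comb.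
- by apply/measurable_EFinP; apply: measurable_funD; apply: measurable_funM => //;
    exact: measurable_running_cost.
- by move=> t _; rewrite lee_fin running_cost_convex.
Qed.

(* Uniform convexity of the cost in the control. *)
Lemma flow_cost_gap (e : R) : 0 < e -> exists2 K : R, 0 <= K & forall x y u v,
  u \in Lfun mu q%:E -> v \in Lfun mu q%:E ->
  (\int[mu]_(t in D) (`|u t - v t| `^ q)%:E +
   K%:E * flow_cost (2^-1 *: x + 2^-1 *: y) (fun s => 2^-1 * u s + 2^-1 * v s)%R <=
   (e + K / 2)%:E * (flow_cost x u + flow_cost y v))%E.
Proof.
(* Controls enter the running cost with a factor $1/q$: hence [e / q] here and the constant [q * K]
   below. *)
move=> e0; have [||K K0 HK] := @powR_norm_midpoint_gap _ q (e / q) => //.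
  by rewrite divr_gt0.
have half : 1 - 2^-1 = 2^-1 :> R by field.
exists (q * K) => [|x y u v Lu Lv]; first by rewrite mulr_ge0// ltW.
set w := (fun s : R => 2^-1 * u s + 2^-1 * v s).
have Lw : w \in Lfun mu q%:E by exact: Lfun_comb.
have mw : measurable_fun D (fun t => `|u t - v t| `^ q).
  apply: measurable_norm_powR; apply: measurable_funB.
    exact: measurable_funS (Lfun_measurable Lu).
  exact: measurable_funS (Lfun_measurable Lv).
have qK0 : 0 <= q * K by rewrite mulr_ge0// ltW.
have c0 : 0 <= e + q * K / 2 by rewrite addr_ge0 ?(ltW e0) ?divr_ge0.
rewrite (ge0_muleDr _ (flow_cost_ge0 x u) (flow_cost_ge0 y v)).
rewrite -(flow_costD x y Lu Lv c0 c0) -(flow_costZ _ Lw qK0).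
rewrite -ge0_integralD//; first last.
- by apply/measurable_EFinP; apply: measurable_funM => //; exact: measurable_running_cost.
- by move=> t _; rewrite lee_fin mulr_ge0// running_cost_ge0.
- exact/measurable_EFinP.
apply: ge0_le_integral => //.
- by move=> t _; rewrite -EFinD lee_fin addr_ge0 ?powR_ge0// mulr_ge0// running_cost_ge0.
- apply: emeasurable_funD; apply/measurable_EFinP => //.
  by apply: measurable_funM => //; exact: measurable_running_cost.
- by apply/measurable_EFinP; apply: measurable_funD; apply: measurable_funM => //;
    exact: measurable_running_cost.
move=> t _; rewrite -EFinD lee_fin /running_cost flow_linear;
  [|exact: Lfun_locint Lu|exact: Lfun_locint Lv].
have := HK (u t) (v t).
have := @Fconv (flow x u t) (flow y v t) 2^-1.
rewrite half => /(_ _)/wrap[]; first by apply/andP; split; lra.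
have -> : (u t + v t) / 2 = w t by rewrite /w; field.
move: (F_ge0 (flow x u t)) (F_ge0 (flow y v t)).
set A := `|u t| `^ q; set B := `|v t| `^ q; set G := `|w t| `^ q.
set Fx := F (flow x u t); set Fy := F (flow y v t); set Fm := F _.
move=> Fx0 Fy0 Fm_le le_gap.
have : q * K * Fm <= q * K * (2^-1 * Fx + 2^-1 * Fy) by rewrite ler_wpM2l.
have : 0 <= e * (Fx + Fy) by rewrite mulr_ge0 ?(ltW e0) ?addr_ge0.
have E1 : (e + q * K / 2) * (A / q + Fx) + (e + q * K / 2) * (B / q + Fy) =
  e / q * (A + B) + K * ((A + B) / 2) + e * (Fx + Fy) +
  q * K * (2^-1 * Fx + 2^-1 * Fy) by field; rewrite gt_eqF.
have E2 : q * K * (G / q + Fm) = K * G + q * K * Fm by field; rewrite gt_eqF.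
rewrite E1 E2; move: le_gap; rewrite mulrBr; lra.
Qed.

Lemma integral_powR_le_flow_cost x u : u \in Lfun mu q%:E ->
  (\int[mu]_(t in D) (`|u t| `^ q)%:E <= q%:E * flow_cost x u)%E.
Proof.
move=> Lu; rewrite -(flow_costZ _ Lu (ltW q0)); apply: ge0_le_integral => //.
- apply/measurable_EFinP; apply: measurable_norm_powR.
  exact: measurable_funS (Lfun_measurable Lu).
- by apply/measurable_EFinP; apply: measurable_funM => //; exact: measurable_running_cost.
- move=> t _; rewrite lee_fin /running_cost mulrDr mulrC divfK ?gt_eqF// lerDl.
  by rewrite mulr_ge0// ltW.
Qed.

(** * Existence of an optimal control *)

(** The midpoint control is admissible, so it costs at least [V]. In [flow_cost_gap] the terms
    [K * V] then cancel, leaving [2 * (e * (V + d)) + K * d]. *)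
Lemma near_minimizers x (V eta : R) : value q F T x = V%:E -> 0 < eta ->
  exists2 d : R, 0 < d & forall u v,
    u \in Lfun mu q%:E -> v \in Lfun mu q%:E ->
    (flow_cost x u <= (V + d)%:E)%E -> (flow_cost x v <= (V + d)%:E)%E ->
    (\int[mu]_(t in D) (`|u t - v t| `^ q)%:E <= eta%:E)%E.
Proof.
move=> VE eta0; have V0 : 0 <= V by rewrite -lee_fin -VE value_ge0.
have V1 : 0 < V + 1 by lra.
(* Since [d <= 1], this [e] makes [2 * (e * (V + d))] at most [eta / 2]; the [d] below, chosen after
   [K], does the same for [K * d]. *)
pose e := eta / (4 * (V + 1)).
have e0 : 0 < e by rewrite divr_gt0// mulr_gt0.
have [K K0 HK] := flow_cost_gap e0.
have K1 : 0 < K + 1 by lra.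
pose d := Num.min 1 (eta / (2 * (K + 1))).
have d0 : 0 < d by rewrite lt_min ltr01 divr_gt0// mulr_gt0.
have d1 : d <= 1 by rewrite ge_min lexx.
have dK : d <= eta / (2 * (K + 1)) by rewrite ge_min lexx orbT.
exists d => // u v Lu Lv Ju Jv; have := HK x x u v Lu Lv.
rewrite -scalerDl (_ : 2^-1 + 2^-1 = 1) ?scale1r; last by field.
set w := (fun s : R => _); set I := (\int[mu]_(t in D) _)%E => HI.
have Lw : w \in Lfun mu q%:E by exact: Lfun_comb.
have {HI} : (I + K%:E * V%:E <= (e + K / 2)%:E * ((V + d)%:E + (V + d)%:E))%E.
  apply: (@le_trans _ _ (I + K%:E * flow_cost x w)%E).
    by apply: leeD => //; apply: lee_wpmul2l; rewrite ?lee_fin// -VE value_le.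
  apply: (le_trans HI); apply: lee_wpmul2l; last exact: leeD.
  by rewrite lee_fin addr_ge0 ?(ltW e0)// divr_ge0.
rewrite -EFinM -EFinD -EFinM -leeBrDr// -EFinB => /le_trans; apply; rewrite lee_fin.
have H1 : e * (V + d) <= eta / 4.
  apply: (@le_trans _ _ (e * (V + 1))); first by rewrite ler_wpM2l ?(ltW e0)//; lra.
  by rewrite le_eqVlt; apply/orP; left; apply/eqP; rewrite /e; field; rewrite gt_eqF.
have H2 : K * d <= eta / 2.
  apply: (@le_trans _ _ ((K + 1) * (eta / (2 * (K + 1))))).
    by apply: ler_pM => //; lra.
  by rewrite le_eqVlt; apply/orP; left; apply/eqP; field; rewrite gt_eqF.
have -> : (e + K / 2) * (V + d + (V + d)) - K * V = 2 * (e * (V + d)) + K * d by field.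
lra.
Qed.

Lemma flow_cvg x (u_ : nat -> R -> R) u t : D t -> (forall k, u_ k \in Lfun mu q%:E) ->
  u \in Lfun mu q%:E ->
  (forall k, \int[mu]_(s in D) (`|u s - u_ k s| `^ q)%:E <= k.+1%:R^-1%:E)%E ->
  flow x (u_ k) t @[k --> \oo] --> flow x u t.
Proof.
move=> tD Lu_ Lu u_u; apply: cvg_cV => i; apply/cvgrPdist_lt => e e0.
have t0 : 0 <= t by case: tD.
pose A := t ^+ (n - i) + 1.
have A0 : 0 < A by rewrite ltr_wpDl// exprn_ge0.
(* The part [A * (e' * t)] is below [e / 2]; [k] is then taken so large that the part with the fixed
   factor [B] is as well. *)
pose e' := e / (2 * A * (t + 1)).
have t1 : 0 < t + 1 by lra.
have e'0 : 0 < e' by rewrite divr_gt0// !mulr_gt0.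
pose B := e' * e'^-1 `^ q.
have B0 : 0 < B by rewrite mulr_gt0// powR_gt0// invr_gt0.
near=> k.
have iu : locint u by exact: Lfun_locint Lu.
have iuk : locint (u_ k) by exact: Lfun_locint (Lu_ k).
apply: (le_lt_trans (flow_dist x i iu iuk t0)).
set I := \int[mu]_(s in `[0, t]) _.
have I_le : I <= e' * t + B * k.+1%:R^-1.
  have mw : measurable_fun setT (fun s => u s - u_ k s).
    by apply: measurable_funB; [exact: Lfun_measurable Lu|exact: Lfun_measurable (Lu_ k)].
  have := integral_norm_le q1 e'0 t0 mD (horizon_itv tD) mw (u_u k).
  rewrite -/B -lee_fin /I /Rintegral fineK//.
  apply: integrable_fin_num => //.
  exact: (integrable_norm (integrableB _ (iu t) (iuk t))).
have kB : B * k.+1%:R^-1 < e / (2 * A).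
  rewrite mulrC -ltr_pdivlMr//; near: k.
  by apply: near_infty_natSinv_lt (PosNum (divr_gt0 _ B0)); rewrite divr_gt0// mulr_gt0.
have I0 : 0 <= I by apply: Rintegral_ge0.
have AI : A * I < e.
  have : A * (e' * t + B * k.+1%:R^-1) < A * (e / (2 * A) + e / (2 * A)).
    rewrite ltr_pM2l// ler_ltD//.
    rewrite (_ : e / (2 * A) = e' * (t + 1)); last by rewrite /e'; field; rewrite !gt_eqF.
    by rewrite ler_pM2l//; lra.
  have -> : A * (e / (2 * A) + e / (2 * A)) = e by field; rewrite gt_eqF.
  by apply: le_lt_trans; rewrite ler_pM2l.
by apply: le_lt_trans AI; rewrite ler_wpM2r// lerDl.
Unshelve. all: by end_near. Qed.

Lemma value_adherent x (V e : R) : value q F T x = V%:E -> 0 < e ->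
  exists u, u \in Lfun mu q%:E /\ (flow_cost x u <= (V + e)%:E)%E.
Proof.
move=> VE e0; have [|_ [u Lu <-]] := lb_ereal_inf_adherent e0 (_ : value q F T x \is a fin_num).
  by rewrite VE.
rewrite -/(value q F T x) VE -EFinD => ule.
by exists (u \_ D); split; rewrite // -cost_Lq// ltW.
Qed.

Lemma exists_minimizing_control x (V : R) : value q F T x = V%:E ->
  exists2 u, u \in Lfun mu q%:E & (flow_cost x u <= V%:E)%E.
Proof.
(* The rate required by [ae_cvg_powR_summable]; it is also below the rate $1/(k+1)$ of
   [flow_cvg]. *)
move=> VE; pose eta k : R := (1 / (2 ^ (k + 1))%:R) `^ q.
have eta_gt0 k : 0 < eta k by rewrite powR_gt0// divr_gt0// ltr0n expn_gt0.
have eta_le k : eta k <= k.+1%:R^-1.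
  have pk : 0 < (2 ^ (k + 1))%:R :> R by rewrite ltr0n expn_gt0.
  apply: (@le_trans _ _ (1 / (2 ^ (k + 1))%:R)).
    rewrite ge1r_powR ?(ltW q1)// divr_gt0//= ler_pdivrMr// mul1r ler1n expn_gt0//.
  by rewrite div1r lef_pV2 ?posrE// ler_nat addn1 ltnW// ltn_expl.
have [del /all_and2[del0 del_near]] := choice (fun k =>
  let: ex_intro2 d d0 dP := near_minimizers VE (eta_gt0 k) in ex_intro _ d (conj d0 dP)).
(* The minimum over all [del j] with [j <= k] makes every [u_ l] with [l >= k] a [del k]-near
   minimizer, so the sequence is rapidly Cauchy from the start. *)
pose eps k := Num.min (k.+1%:R^-1) (\big[Num.min/1]_(j < k.+1) del j).
have eps_gt0 k : 0 < eps k.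
  rewrite lt_min invr_gt0 ltr0n/=.
  by apply: lt_bigmin => // j _; exact: del0.
have eps_le k : eps k <= k.+1%:R^-1 by rewrite ge_min lexx.
have eps_del k l : (k <= l)%N -> eps l <= del k.
  move=> kl; rewrite ge_min; apply/orP; right.
  by rewrite -ltnS in kl; exact: (bigmin_le_cond _ (fun j : 'I_l.+1 => del j) (j := Ordinal kl)).
have [u_ /all_and2[Lu_ Ju_]] := choice (fun k => value_adherent VE (eps_gt0 k)).
have Ju_le k l : (k <= l)%N -> (flow_cost x (u_ l) <= (V + del k)%:E)%E.
  by move=> kl; apply: (le_trans (Ju_ l)); rewrite lee_fin lerD2l eps_del.
have u_cauchy k l : (k <= l)%N ->
    (\int[mu]_(t in D) (`|u_ l t - u_ k t| `^ q)%:E <= (eta k)%:E)%E.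
  by move=> kl; apply: del_near => //; exact: Ju_le.
have mu_ k : measurable_fun setT (u_ k) by exact: Lfun_measurable (Lu_ k).
have mu_D k : measurable_fun D (u_ k) by exact: measurable_funS (mu_ k).
have ae_filter := ae_filter_ringOfSetsType (@lebesgue_measure R).
have cvg_u : {ae lebesgue_measure, forall t, D t -> cvgn (u_ ^~ t)}.
  by apply: (ae_cvg_powR_summable q1 mD mu_D) => k; exact: u_cauchy.
(* The upper limit is measurable without knowing where the sequence converges, and equals the limit
   almost everywhere on [D]. *)
pose u := (fun t => fine (limn_esup (fun k => (u_ k t)%:E))) \_ D.
have u_u : {ae lebesgue_measure, forall t, D t -> u_ ^~ t @ \oo --> u t}.
  apply: filterS cvg_u => t + tD => /(_ tD) ct.
  rewrite /u patchE mem_set//.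
  have ct' : (u_ k t)%:E @[k --> \oo] --> (limn (u_ ^~ t))%:E.
    by apply: cvg_EFin ct; near=> k.
  by have [_ ->] := cvg_limn_einf_sup ct'.
have mu0 : measurable_fun setT u.
  apply/(measurable_restrict _ mD measurableT); rewrite setTI.
  apply: measurableT_comp => //.
  by apply: measurable_fun_limn_esup => k; apply/measurable_EFinP; exact: mu_D.
have muD : measurable_fun D u by exact: measurable_funS mu0.
have norm_u : (\int[mu]_(t in D) (`|u t| `^ q)%:E <= (q * (V + 1))%:E)%E.
  apply: (@le_integral_lim _ _ R mu D (fun k t => `|u_ k t| `^ q) (fun t => `|u t| `^ q)) => //.
  - by move=> k; apply: measurable_norm_powR; exact: mu_D.
  - exact: measurable_norm_powR.
  - apply: filterS u_u => t + tD => /(_ tD) ct.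
    exact: (continuous_cvg _ (@continuous_norm_powR _ q q0 (u t)) ct).
  - near=> k; apply: (le_trans (integral_powR_le_flow_cost x (Lu_ k))).
    rewrite EFinM; apply: lee_wpmul2l; first by rewrite lee_fin ltW.
    apply: (le_trans (Ju_ k)); rewrite lee_fin lerD2l (le_trans (eps_le k))//.
    by rewrite invf_le1 ?ler1n.
have Lu : u \in Lfun mu q%:E.
  apply/(Lfun_powRP _ q0); split => //.
  apply: (@le_lt_trans _ _ (q * (V + 1))%:E); last exact: ltry.
  apply: le_trans norm_u; rewrite [leRHS]integral_mkcond; apply: ge0_le_integral => //.
  - by apply/measurable_EFinP; exact: measurable_norm_powR.
  - apply/(measurable_restrict _ mD measurableT); rewrite setTI.
    by apply/measurable_EFinP; exact: measurable_norm_powR.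
  - move=> t _; rewrite /u !patchE; case: ifPn => //= _.
    by rewrite normr0 powR0 ?gt_eqF.
(* Fatou's lemma in [l], with [k] fixed, turns the Cauchy estimate into a distance to the limit. *)
have u_near k : (\int[mu]_(t in D) (`|u t - u_ k t| `^ q)%:E <= k.+1%:R^-1%:E)%E.
  apply: (@le_trans _ _ (eta k)%:E); last by rewrite lee_fin.
  apply: (@le_integral_lim _ _ R mu D (fun l t => `|u_ l t - u_ k t| `^ q)
    (fun t => `|u t - u_ k t| `^ q)) => //.
  - by move=> l; apply: measurable_norm_powR; apply: measurable_funB; exact: mu_D.
  - by apply: measurable_norm_powR; apply: measurable_funB => //; exact: mu_D.
  - apply: filterS u_u => t + tD => /(_ tD) ct.
    have {}ct : (fun l => u_ l t - u_ k t) @ \oo --> u t - u_ k t.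
      by apply: cvgB => //; exact: cvg_cst.
    exact: (continuous_cvg _ (@continuous_norm_powR _ q q0 _) ct).
  - by near=> l; apply: u_cauchy; near: l; exact: nbhs_infty_ge.
exists u => //; apply/lee_addgt0Pr => e e0; rewrite -EFinD.
apply: (@le_integral_lim _ _ R mu D (fun k => running_cost x (u_ k)) (running_cost x u)) => //.
- by move=> k; apply: measurable_running_cost; exact: Lu_.
- exact: measurable_running_cost.
- by move=> k t; exact: running_cost_ge0.
- by move=> t; exact: running_cost_ge0.
- apply: filterS u_u => t + tD => /(_ tD) ct; apply: cvgD.
    apply: cvgMl.
    exact: (continuous_cvg _ (@continuous_norm_powR _ q q0 (u t)) ct).
  have xc : flow x (u_ k) t @[k --> \oo] --> flow x u t by exact: flow_cvg.
  exact: (cvg_comp _ F xc (@Fcont (flow x u t))).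
- near=> k; apply: (le_trans (Ju_ k)); rewrite lee_fin lerD2l (le_trans (eps_le k))// ltW//.
  by near: k; exact: near_infty_natSinv_lt (PosNum e0).
Unshelve. all: by end_near. Qed.

(** * Finiteness of the value, attainment and uniqueness *)

Hypothesis F_eq0 : F 0 = 0.

Lemma exists_finite_cost x : exists2 u, u \in Lfun mu q%:E & (flow_cost x u < +oo)%E.
Proof.
have [p pP] := exists_hermite_poly n.+1 (fun k => x (inord k) 0).
pose u := horner p^`(n.+1) \_ `[0, 1].
have m01 : measurable (`[0, 1] : set (measurableTypeR R)) by exact: measurable_itv.
have cu : continuous (fun s => `|(p^`(n.+1)).[s]| `^ q).
  move=> s; exact: (cvg_comp _ (fun y : R => `|y| `^ q)
    (@continuous_horner _ p^`(n.+1) s) (@continuous_norm_powR _ q q0 _)).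
have Lu : u \in Lfun mu q%:E.
  apply/(Lfun_powRP _ q0); split.
    apply/(measurable_restrict _ m01 measurableT); rewrite setTI.
    apply: (@measurable_funS _ _ _ _ setT) => //.
    by apply: continuous_measurable_fun; exact: continuous_horner.
  under eq_integral.
    move=> s _; rewrite (_ : (_)%:E = ((fun s => (`|(p^`(n.+1)).[s]| `^ q)%:E) \_ `[0, 1]) s).
      over.
    by rewrite /u !patchE; case: ifP => //; rewrite normr0 powR0 ?gt_eqF.
  rewrite -integral_mkcond.
  by apply: locint_lty; [move=> s; exact: powR_ge0|exact: locint_continuous].
exists u => //.
(* The running cost up to time 1, continuous and thus integrable there; afterwards control and state
   are 0 and [F 0 = 0]. *)
pose G s : R := `|(p^`(n.+1)).[s]| `^ q / q + F (\col_(i < n.+1) (p^`(i)).[s]).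
have cG : continuous G.
  move=> s; apply: cvgD; first by apply: cvgMl; exact: cu.
  apply: (cvg_comp (fun s => \col_(i < n.+1) (p^`(i)).[s]) F); last exact: Fcont.
  apply: cvg_cV => i; rewrite mxE; under eq_fun do rewrite mxE.
  exact: continuous_horner.
have costE : {in D, running_cost x u =1 G \_ `[0, 1]}.
  move=> t /set_mem[t0 _]; rewrite /running_cost.
  have -> : flow x u t = \col_(i < n.+1) (horner p^`(i) \_ `[0, 1]) t.
    apply/matrixP => i j; rewrite !mxE chain_poly ?leq_subr//.
      by rewrite subKn// ltnW.
    move=> k kn; have [-> ->] := pP _ kn; split => //.
    by rewrite /rev_coord/= subKn.
  rewrite /u !patchE; case: ifPn => t01.
    by congr (_ + F _); apply/matrixP => i j; rewrite !mxE patchE t01.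
  (* Outside of [[0, 1]] the restriction takes the default value [point], which is 0 in [R]. *)
  rewrite -[point]/(0 : R).
  rewrite normr0 powR0 ?gt_eqF// mul0r add0r -[RHS]F_eq0; congr F.
  by apply/matrixP => i j; rewrite !mxE patchE ifF//; exact/negbTE.
have G0 s : 0 <= G s by rewrite addr_ge0// divr_ge0 ?powR_ge0// ltW.
apply: (@le_lt_trans _ _ (\int[mu]_(s in `[0%R, 1%R]) (G s)%:E)%E).
  have -> : flow_cost x u = (\int[mu]_(t in D) ((EFin \o G) \_ `[0%R, 1%R]) t)%E.
    by apply: eq_integral => t tD; rewrite costE// !patchE; case: ifP.
  rewrite -integral_mkcondr; apply: ge0_subset_integral => //.
  - exact: measurableI.
  - by apply/measurable_EFinP/measurable_funTS; exact: continuous_measurable_fun.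
  - by move=> s _; rewrite lee_fin.
by apply: locint_lty => //; exact: locint_continuous.
Qed.

Lemma value_fin x : value q F T x \is a fin_num.
Proof.
have [u Lu fin] := exists_finite_cost x.
by rewrite ge0_fin_numE ?value_ge0//; apply: le_lt_trans (value_le x Lu) fin.
Qed.

Lemma value_attained x : exists2 u, u \in Lfun mu q%:E & flow_cost x u = value q F T x.
Proof.
have [u Lu Ju] := exists_minimizing_control (esym (fineK (value_fin x))).
exists u => //; apply/eqP; rewrite eq_le value_le// andbT.
by rewrite -[leRHS]fineK// value_fin.
Qed.

Lemma value_real : exists V, forall x, value q F T x = (V x)%:E.
Proof. by exists (fine \o value q F T) => x /=; rewrite fineK ?value_fin. Qed.

Lemma value_convex x y (a : R) : 0 <= a <= 1 ->
  (value q F T (a *: x + (1 - a) *: y) <=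
   a%:E * value q F T x + (1 - a)%:E * value q F T y)%E.
Proof.
move=> a01; have [u Lu <-] := value_attained x; have [v Lv <-] := value_attained y.
apply: le_trans (flow_cost_convex x y Lu Lv a01); apply: value_le.
exact: Lfun_comb.
Qed.

Lemma minimizer_flow_cost x u : minimizer q F T x u ->
  u \_ D \in Lfun mu q%:E /\ flow_cost x (u \_ D) = value q F T x.
Proof.
move=> [Lu umin]; split => //; rewrite -cost_Lq//.
apply/eqP; rewrite eq_le; apply/andP; split.
  by apply: le_ereal_inf_tmp => _ [v Lv <-]; exact: umin.
by apply: ereal_inf_lbound; exists u.
Qed.

Lemma value_minimizer x : exists u, minimizer q F T x u.
Proof.
have [u Lu Ju] := value_attained x; exists u; split; first exact: Lfun_Lq.
move=> v Lv; rewrite cost_flow_cost// Ju.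
by apply: ereal_inf_lbound; exists v.
Qed.

(** Two minimizers are [d]-near minimizers for every [d], so by [near_minimizers] the integral of
    $|u-v|^q$ is below every positive bound. *)
Lemma minimizer_unique x u v : minimizer q F T x u -> minimizer q F T x v ->
  ae_eq mu D u v.
Proof.
move=> /minimizer_flow_cost[Lu Ju] /minimizer_flow_cost[Lv Jv].
pose w t := `|(u \_ D) t - (v \_ D) t| `^ q.
have mw : measurable_fun D w.
  apply: measurable_norm_powR; apply: measurable_funB;
    by apply: measurable_funTS; apply: (@Lfun_measurable _ q).
have w_eq0 : (\int[mu]_(t in D) `|(w t)%:E| = 0)%E.
  apply/eqP; rewrite eq_le integral_ge0// andbT.
  apply/lee_addgt0Pr => e e0; rewrite add0e.
  have [d d0 H] := near_minimizers (esym (fineK (value_fin x))) e0.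
  under eq_integral do rewrite gee0_abs ?lee_fin ?powR_ge0//.
  by apply: H; rewrite // EFinD fineK ?value_fin// ?Ju ?Jv leeDl// lee_fin ltW.
have /ae_eq_integral_abs := w_eq0; move=> /(_ mD) H.
have {H} := H _; rewrite /ae_eq; move=> /(_ _)/wrap[]; first exact/measurable_EFinP.
have ae_filter := ae_filter_ringOfSetsType (@lebesgue_measure R).
apply: filterS => t + tD => /(_ tD) [].
rewrite /w !patchE mem_set// => /powR_eq0_eq0/eqP.
by rewrite normr_eq0 subr_eq0 => /eqP.
Qed.

Lemma flow_0 x u : flow x u 0 = x.
Proof.
apply/matrixP => i j; rewrite (ord1 j) flowE set_itv1 Rintegral_set1 addr0 //.
Qed.

Lemma value_0 : value q F T 0 = 0%E.
Proof.
apply/eqP; rewrite eq_le value_ge0 andbT.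
have L0 : (fun=> 0 : R) \in Lfun mu q%:E.
  apply/(Lfun_powRP _ q0); split; first exact: measurable_cst.
  by under eq_integral do rewrite normr0 powR0 ?gt_eqF//; rewrite integral0 ltry.
apply: (le_trans (value_le 0 L0)).
rewrite /flow_cost (_ : running_cost 0 (fun=> 0) = cst 0) ?integral0//.
apply/funext => t; rewrite /running_cost/= normr0 powR0 ?gt_eqF// mul0r add0r -[RHS]F_eq0.
congr F; apply/matrixP => i j; rewrite !mxE chain_control0// => k _.
by rewrite /rev_coord mxE.
Qed.

(** * Positivity of the value *)

Hypotheses (T_gt0 : (0 < T)%E) (F_gt0 : forall x, x != 0 -> 0 < F x).

Lemma flow_cost_gt0 x u : x != 0 -> u \in Lfun mu q%:E -> (0 < flow_cost x u)%E.
Proof.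
move=> x0 Lu; have Fx0 := F_gt0 x0.
have cF : F (flow x u t) @[t --> nbhs (0 : R)] --> F x.
  rewrite -[in X in _ --> X](flow_0 x u).
  have cf : flow x u t @[t --> nbhs (0 : R)] --> flow x u 0.
    by apply: flow_continuous; exact: Lfun_locint Lu.
  exact: (cvg_comp _ F cf (@Fcont _)).
have : \forall t \near (0 : R), F x / 2 < F (flow x u t).
  by apply: (cvgr_gt _ cF); lra.
have [t0 t0_gt0 t0T] : exists2 t, 0 < t & (t%:E < T)%E.
  case: T T_gt0 => [r||]//; rewrite ?lte_fin => r0.
    by exists (r / 2); rewrite ?lte_fin; lra.
  by exists 1; rewrite ?ltry.
(* On [[0, s]] the state is close enough to [x] that [F] exceeds [F x / 2], and [s <= t0 < T] keeps
   this interval inside the horizon. *)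
move=> [d /= d0 near0]; pose s := Num.min (d / 2) t0.
have s0 : 0 < s by rewrite lt_min t0_gt0 divr_gt0.
have sd : s < d by rewrite gt_min; apply/orP; left; lra.
have sD : `[0, s] `<=` D.
  move=> t /=; rewrite in_itv/= => /andP[t_ge0 ts]; split => //.
  by apply: le_lt_trans t0T; rewrite lee_fin (le_trans ts)// ge_min lexx orbT.
apply: (@lt_le_trans _ _ (\int[mu]_(t in `[0%R, s]) (F x / 2)%:E)%E).
  rewrite integral_cst//= lebesgue_measure_itv/= lte_fin s0 sube0 -EFinM lte_fin.
  by rewrite mulr_gt0// divr_gt0.
apply: (@le_trans _ _ (\int[mu]_(t in `[0%R, s]) (running_cost x u t)%:E)%E).
  apply: ge0_le_integral => //.
  - by move=> t _; rewrite lee_fin divr_ge0// ltW.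
  - by apply/measurable_EFinP; exact: measurable_running_cost.
  - move=> t /=; rewrite in_itv/= => /andP[t_ge0 ts]; rewrite lee_fin.
    apply: (@le_trans _ _ (F (flow x u t))).
      by apply/ltW/near0; rewrite /= sub0r normrN ger0_norm// (le_lt_trans ts).
    by rewrite lerDr divr_ge0 ?powR_ge0// ltW.
apply: ge0_subset_integral => //.
- by apply/measurable_EFinP; exact: measurable_running_cost.
- by move=> t _; rewrite lee_fin running_cost_ge0.
Qed.

Lemma value_gt0 x : x != 0 -> (0 < value q F T x)%E.
Proof. by move=> x0; have [u Lu <-] := value_attained x; exact: flow_cost_gt0. Qed.

(** * Strict convexity on the infinite horizon *)

(** [F] has a positive minimum on the sphere of radius [d], by compactness; convexity and [F 0 = 0]
    make [F] nondecreasing along rays, which covers the outside. The transpositions serve to work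
    with a compact set of row vectors. *)
Lemma F_away_gt0 (d : R) : 0 < d ->
  exists2 m, 0 < m & forall x, (exists i, d <= `|x i 0|) -> m <= F x.
Proof.
move=> d0; pose S := [set v : 'rV[R]_n.+1 | `|v| = d].
have cS : compact S.
  apply: bounded_closed_compact.
    by exists d; split; [exact: num_real|move=> r dr v /= ->; exact: ltW].
  rewrite (_ : S = (fun v : 'rV[R]_n.+1 => `|v|) @^-1` [set d])//.
  by apply: closed_comp => [v _|]; [exact: norm_continuous|exact: closed_eq].
have cFT : continuous (fun v : 'rV[R]_n.+1 => F v^T).
  move=> v; have cT : (w^T @[w --> nbhs v] --> v^T).
    apply: cvg_cV => i; rewrite mxE; under eq_fun do rewrite mxE.
    exact: coord_continuous.
  exact: (cvg_comp _ F cT (@Fcont _)).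
have [m m0 mS] : exists2 m, 0 < m & forall v : 'rV_n.+1, S v -> m <= F v^T.
  have [S0|/set0P S0] := eqVneq S set0; first by exists 1 => // v; rewrite S0.
  have [v vS vmin] := compact_EVT_min S0 cS (continuous_subspaceT cFT).
  exists (F v^T); last by move=> w wS; apply: vmin; rewrite inE.
  apply: F_gt0; apply: contraTneq d0 => vT0; move: vS; rewrite inE /S/= => <-.
  by rewrite -[v]trmxK vT0 trmx0 normr0 ltxx.
exists m => // x [i dx]; pose N := `|x^T|.
have N_ge : d <= N.
  apply: (le_trans dx); rewrite /N [leRHS]/Num.norm/= mx_normrE.
  by apply/bigmax_geP; right; exists (0, i); rewrite //= mxE.
have N0 : 0 < N by exact: lt_le_trans N_ge.
have dN : 0 <= d / N <= 1.
  by rewrite divr_ge0 ?(ltW d0) ?(ltW N0)//= ler_pdivrMr// mul1r.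
have := mS ((d / N) *: x^T); rewrite /S/= normrZ ger0_norm; last by case/andP: dN.
rewrite -/N divfK ?gt_eqF// => /(_ erefl); rewrite linearZ/= trmxK => /le_trans; apply.
have := Fconv x 0 dN; rewrite scaler0 addr0 F_eq0 mulr0 addr0 => /le_trans; apply.
by rewrite ler_piMl//; case/andP: dN.
Qed.

(** [flow_cvg] for the constant sequence [v], with uniqueness of limits. *)
Lemma flow_eq x u v t : u \in Lfun mu q%:E -> v \in Lfun mu q%:E -> D t ->
  (\int[mu]_(s in D) (`|u s - v s| `^ q)%:E <= 0)%E -> flow x u t = flow x v t.
Proof.
move=> Lu Lv tD uv0.
have H := @flow_cvg x (fun=> v) u t tD (fun=> Lv) Lu.
have {H} H : flow x v t @[k --> \oo] --> flow x u t.
  by apply: H => k; apply: (le_trans uv0); rewrite lee_fin invr_ge0.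
rewrite -(cvg_lim (@norm_hausdorff _ _) H).
by apply: (cvg_lim (@norm_hausdorff _ _)); exact: cvg_cst.
Qed.

Lemma flow_diff_coord x y u : x != y -> u \in Lfun mu q%:E ->
  exists2 i, x i 0 - y i 0 != 0 &
    forall t, flow x u t i 0 - flow y u t i 0 = x i 0 - y i 0.
Proof.
move=> xy Lu; have xy0 : x - y != 0 by rewrite subr_eq0.
have [i xyi iE] := flow_control0_coord xy0.
exists i => [|t]; first by move: xyi; rewrite !mxE.
have iu : locint u by exact: Lfun_locint Lu.
have := flow_linear x y 1 (-1) t iu iu; rewrite !scale1r !scaleN1r.
rewrite (_ : (fun s => _) = fun=> 0); last by apply/funext => s; rewrite mul1r mulN1r subrr.
by move=> /matrixP/(_ i 0); rewrite iE !mxE.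
Qed.

Lemma value_midpoint_lt x y (V : 'cV[R]_n.+1 -> R) :
  (forall x, value q F T x = (V x)%:E) -> T = +oo%E -> x != y ->
  V (2^-1 *: x + 2^-1 *: y) < 2^-1 * V x + 2^-1 * V y.
Proof.
move=> VE Ty xy; rewrite ltNge; apply/negP => V_le.
have [u Lu Ju] := value_attained x; have [v Lv Jv] := value_attained y.
rewrite VE in Ju; rewrite VE in Jv.
set I := (\int[mu]_(t in D) (`|v t - u t| `^ q)%:E)%E.
have I_le0 : (I <= 0)%E.
  have a0 : 0 <= V x by rewrite -lee_fin -VE value_ge0.
  have b0 : 0 <= V y by rewrite -lee_fin -VE value_ge0.
  apply/lee_addgt0Pr => e e0; rewrite add0e.
  have ab0 : 0 < V x + V y + 1 by lra.
  (* If the midpoint inequality is not strict, the terms with [K] cancel; the remaining term is then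
     at most [e], the added 1 avoiding a zero denominator. *)
  have [K K0 HK] := flow_cost_gap (divr_gt0 e0 ab0).
  have := HK x y u v Lu Lv; rewrite Ju Jv -EFinD -EFinM; set w := (fun s : R => _) => H.
  have Lw : w \in Lfun mu q%:E by exact: Lfun_comb.
  have Jw : ((2^-1 * V x + 2^-1 * V y)%:E <= flow_cost (2^-1 *: x + 2^-1 *: y) w)%E.
    by apply: le_trans (value_le _ Lw); rewrite VE lee_fin.
  have {H} : (I + (K * (2^-1 * V x + 2^-1 * V y))%:E <=
      ((e / (V x + V y + 1) + K / 2) * (V x + V y))%:E)%E.
    apply: le_trans H; rewrite EFinM; apply: leeD; last by apply: lee_wpmul2l; rewrite ?lee_fin.
    by rewrite le_eqVlt; apply/orP; left; apply/eqP; apply: eq_integral => t _; rewrite distrC.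
  rewrite -leeBrDr// -EFinB => /le_trans; apply; rewrite lee_fin.
  have -> : (e / (V x + V y + 1) + K / 2) * (V x + V y) - K * (2^-1 * V x + 2^-1 * V y) =
    e / (V x + V y + 1) * (V x + V y) by field; rewrite gt_eqF.
  by rewrite mulrAC ler_pdivrMr// ler_pM2l//; lra.
have [i xyi iE] := flow_diff_coord xy Lu.
set c := `|x i 0 - y i 0|; have c0 : 0 < c by rewrite normr_gt0.
have [m m0 mF] := F_away_gt0 (divr_gt0 c0 (ltr0n _ 2)).
(* The two [i]-th coordinates keep a difference of absolute value [c], so at each time one of them
   is at least [c / 2] in absolute value. *)
have F_ge t : D t -> m <= F (flow x u t) + F (flow y v t).
  move=> tD; rewrite (flow_eq y Lv Lu tD I_le0).
  have [h|h] := leP (c / 2) `|flow x u t i 0|.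
    apply: (@le_trans _ _ (F (flow x u t))); last by rewrite lerDl.
    by apply: mF; exists i.
  apply: (@le_trans _ _ (F (flow y u t))); last by rewrite lerDr.
  apply: mF; exists i.
  have : c <= `|flow x u t i 0| + `|flow y u t i 0| by rewrite /c -(iE t) ler_normB.
  lra.
have : ((+oo : \bar R) <= 1%:E * flow_cost x u + 1%:E * flow_cost y v)%E.
  rewrite -flow_costD//; apply: (@le_trans _ _ (\int[mu]_(t in D) m%:E)%E).
    rewrite integral_cst// (_ : horizon T = `[0, +oo[%classic).
      by rewrite /= lebesgue_measure_itv/= ltry gt0_muley ?lte_fin.
    by rewrite predeqE => t; rewrite /horizon/= Ty in_itv/= ltry andbT; split=> [[]|].
  apply: ge0_le_integral => //.
  - by move=> t _; rewrite lee_fin ltW.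
  - by apply/measurable_EFinP; apply: measurable_funD; apply: measurable_funM => //;
      exact: measurable_running_cost.
  - move=> t tD; rewrite lee_fin !mul1r (le_trans (F_ge t tD))//.
    by rewrite /running_cost lerD// lerDr divr_ge0 ?powR_ge0// ltW.
by rewrite !mul1e Ju Jv -EFinD leye_eq.
Qed.

Lemma value_strictly_convex x y (a : R) : T = +oo%E -> x != y -> 0 < a < 1 ->
  (value q F T (a *: x + (1 - a) *: y) <
   a%:E * value q F T x + (1 - a)%:E * value q F T y)%E.
Proof.
move=> Ty xy a01; have [V VE] := value_real.
(* Exchanging the two points replaces [a] by [1 - a], so weights up to 1/2 suffice. *)
suff strict (x' y' : 'cV_n.+1) b : x' != y' -> 0 < b <= 2^-1 ->
    V (b *: x' + (1 - b) *: y') < b * V x' + (1 - b) * V y'.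
  rewrite !VE -!EFinM -EFinD lte_fin; have /andP[a0 a1] := a01.
  have [a2|a2] := leP a 2^-1; first by apply: strict; rewrite ?a0.
  rewrite [X in V X]addrC [ltRHS]addrC.
  have := strict y x (1 - a); rewrite subKr; apply.
    by rewrite eq_sym.
  by apply/andP; split; lra.
move=> {}xy /andP[b0 b2]; set z := 2^-1 *: x' + 2^-1 *: y'.
(* The point lies between the midpoint [z] and [y']; since [b > 0], the strict inequality at [z]
   enters with positive weight [2 * b]. *)
have -> : b *: x' + (1 - b) *: y' = (2 * b) *: z + (1 - 2 * b) *: y'.
  rewrite /z scalerDr !scalerA -addrA -scalerDl.
  by congr (_ *: _ + _ *: _); field.
have b01 : 0 <= 2 * b <= 1 by apply/andP; split; lra.
have := value_convex z y' b01; rewrite !VE -!EFinM -EFinD lee_fin => /le_lt_trans; apply.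
have := value_midpoint_lt VE Ty xy; rewrite -/z => vz_lt.
have : (2 * b) * V z < (2 * b) * (2^-1 * V x' + 2^-1 * V y') by rewrite ltr_pM2l// mulr_gt0.
have -> : 2 * b * (2^-1 * V x' + 2^-1 * V y') = b * V x' + b * V y' by field.
rewrite !mulrBl !mul1r; lra.
Qed.

End optimal_control.

Theorem theorem2p2 (R : realType) (n : nat) (q : R) (q1 : 1 < q)
    (F : 'cV[R]_n.+1 -> R)
    (FC1 : continuously_differentiable F)
    (Fconvex : convex_function [set: convex_lmodType 'cV[R]_n.+1] F)
    (Fposdef : positive_definite (fun x => (F x)%:E))
    (T : \bar R) (T0 : (0 < T)%E) :
  (forall x0 : 'cV[R]_n.+1,
     exists u : R -> R, minimizer q F T x0 u /\
       forall v : R -> R, minimizer q F T x0 v ->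
         ae_eq (@lebesgue_measure R) (horizon T) u v) /\
  positive_definite (value q F T) /\
  econvex (value q F T) /\
  (T = +oo%E -> strictly_econvex (value q F T)).
Proof.
have Fcont : continuous F.
  by move=> x; apply: differentiable_continuous; exact: FC1.1.
have F_eq0 : F 0 = 0 by case: Fposdef => -[].
have F_gt0 x : x != 0 -> 0 < F x by case: Fposdef => _ /[apply]; rewrite lte_fin.
have F_ge0 x : 0 <= F x.
  by have [->|/F_gt0/ltW//] := eqVneq x 0; rewrite F_eq0.
have Fconv x y (t : R) : 0 <= t <= 1 ->
    F (t *: x + (1 - t) *: y) <= t * F x + (1 - t) * F y.
  by move=> /andP[t0 t1]; have := Fconvex (Itv01 t0 t1) x y; apply; rewrite inE.
split; last split; last split.
- move=> x; have [u umin] := @value_minimizer _ _ _ _ T q1 Fcont F_ge0 Fconv F_eq0 x.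
  exists u; split => // v vmin.
  exact: (minimizer_unique q1 Fcont F_ge0 Fconv F_eq0 umin vmin).
- split; first exact: value_0.
  by move=> x; exact: value_gt0.
- by move=> x y t t01; exact: value_convex.
- by move=> Ty x y t xy t01; exact: value_strictly_convex.
Qed.
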